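(* Let $(W,S)$ be a reducible finite Coxeter system with irreducible components $(W_t,S_t)$ for $t=1,\ldots,\ell$, so that $W=\prod_{t=1}^{\ell}W_t$ and $S=\bigsqcup_{t=1}^{\ell}S_t$. If $|\Omega(W_t,\mathcal{P}_{W_t})^\times|=4$ for every $t$, then the following hold: (i) $|\Omega(W,\mathcal{P}_W)^\times|=2^{\ell+1}$. (ii) $\Omega(W,\mathcal{P}_W)^\times=\langle -1_{\Omega(W)},f_1(\varepsilon_{W_1}),\ldots,f_\ell(\varepsilon_{W_\ell})\rangle$, where $\varepsilon_{W_i}$ is the sign unit of $\Omega(W_i,\mathcal{P}_{W_i})$.
   Context: For a finite group $G$, a collection of $G$ is a family $\mathcal{D}$ of subgroups containing $G$ and closed under intersection and $G$-conjugation. $\Omega(G,\mathcal{D})$ (the partial Burnside ring) is the subring of the Burnside ring $\Omega(G)$ that is the $\mathbb{Z}$-span of the classes $[G/H]$, $H\in\mathcal{D}$. $R^\times$ is the unit group of a ring $R$. For a finite Coxeter system $(W,S)$, a parabolic subgroup is a subgroup conjugate in $W$ to $\langle J\rangle$ for some $J\subseteq S$; $\mathcal{P}_W$ is the set of all parabolic subgroups, which is a collection of $W$. The sign unit of $\Omega(W,\mathcal{P}_W)$ is $\varepsilon_W:=\sum_{J\subseteq S}(-1)^{|J|}[W/\langle J\rangle]$, which is known to be a unit with $\varphi^W_P(\varepsilon_W)=(-1)^{|J|}$ whenever $P$ is conjugate to $\langle J\rangle$, where $\varphi^W_P$ denotes the ring homomorphism to $\mathbb{Z}$ sending $[X]$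 to the number of $P$-fixed points of $X$. For $W=\prod_i W_i$ as in the claim, $\mathcal{P}_W=\{P_1\times\cdots\times P_\ell: P_i\in\mathcal{P}_{W_i}\}$, and $f_j\colon\Omega(W_j,\mathcal{P}_{W_j})\to\Omega(W,\mathcal{P}_W)$ is the injective ring homomorphism given by $f_j([W_j/H])=[W/(W_1\times\cdots\times W_{j-1}\times H\times W_{j+1}\times\cdots\times W_\ell)]$. *)

(* Defs.v *)
From HB Require Import structures.
From mathcomp Require Import all_boot all_order all_algebra all_fingroup.

Set Implicit Arguments.
Unset Strict Implicit.
Unset Printing Implicit Defensive.

Import GroupScope GRing.Theory.
Local Open Scope ring_scope.

(* Group actions are right actions, as in MathComp: the G-set G/H is the set  *)
(* rcosets H G of right cosets, on which G acts by right translation ('Rs).   *)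

Section ProductAction.

Variables (aT : finGroupType) (D : {set aT}) (T1 T2 : finType).
Variables (to1 : action D T1) (to2 : action D T2).

Definition pair_act (u : T1 * T2) (a : aT) := (to1 u.1 a, to2 u.2 a).

Lemma pair_act_is_action : is_action D pair_act.
Proof.
split=> [a [x1 x2] [y1 y2] [/act_inj-> /act_inj->] // | [x1 x2] a b Da Db].
by rewrite /pair_act /= !actMin.
Qed.

Canonical pair_action := Action pair_act_is_action.

End ProductAction.

Section Burnside.

Variables (gT : finGroupType) (G : {group gT}).

(* One representative of each G-conjugacy class of subgroups of G. *)
Definition subgroup_reps : {set {group gT}} :=
  orbit_transversal 'JG G (subgroups G).

Definition subgroup_class := {H : {group gT} | H \in subgroup_reps}.

HB.instance Definition _ := SubFinite.on subgroup_class.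

Definition class_rep (C : subgroup_class) : {group gT} := val C.

(* The free abelian group on the isomorphism classes of transitive G-sets.   *)
Definition burnside := {ffun subgroup_class -> int}.

HB.instance Definition _ := GRing.Zmodule.on burnside.

(* The class [G/H], for H a subgroup of G. *)
Definition Gclass (H : {group gT}) : burnside :=
  [ffun C : subgroup_class => (H \in orbit 'JG G (class_rep C))%:R].

(* The class of a finite G-set A: the sum of the classes of its orbits. *)
Definition gset_class (D : {group gT}) (T : finType) (to : action D T)
    (A : {set T}) : burnside :=
  \sum_(x in orbit_transversal to G A) Gclass 'C_G[x | to].

(* [G/H] * [G/K] is the class of the G-set G/H x G/K. *)
Definition burnside_mul (x y : burnside) : burnside :=
  \sum_(C : subgroup_class) \sum_(D : subgroup_class)
    gset_class (pair_action 'Rs 'Rs) (setX (rcosets (class_rep C) G) (rcosets (class_rep D) G))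
      *~ (x C * y D).

(* The mark phi_H, which counts H-fixed points. *)
Definition mark (H : {group gT}) (x : burnside) : int :=
  \sum_(C : subgroup_class) #|'Fix_(rcosets (class_rep C) G | 'Rs)(H)|%:Z * x C.

Lemma fix_orbit (D : {group gT}) (T : finType) (to : action D T) x
    (H : {group gT}) : G \subset D -> H \subset G ->
  #|'Fix_(orbit to G x | to)(H)| = #|'Fix_(rcosets 'C_G[x | to] G | 'Rs)(H)|.
Proof.
move=> sGD sHG.
have sHD := subset_trans sHG sGD.
have act_fix (a : gT) : a \in G ->
  (to x a \in 'Fix_to(H)) = ('C_G[x | to] :* a \in 'Fix_('Rs)(H)).
  move=> Ga; rewrite -sub_astab1_in // astab1_act_in ?(subsetP sGD) //.
  transitivity (H \subset G :&: 'C[x | to] :^ a); first by rewrite subsetI sHG.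
  by rewrite -[in LHS](conjGid Ga) -conjIg -sub_afixRs_norms.
rewrite -(@card_in_imset _ _ (to x \o repr)); last first.
  apply: (@can_in_inj _ _ _ _ (amove to G x)) => C /setIP[rC _].
  exact: act_reprK.
apply/esym/eq_card => y; apply/imsetP/setIP=> [[C /setIP[rC fC] ->] | [/orbitP[a Ga <-] fy]].
  have /rcosetsP[a Ga eC] := rC.
  have rG: repr C \in G.
    rewrite eC; have := mem_repr_rcoset ('C_G[x | to])%G a.
    by case/rcosetP=> c /setIP[Gc _] ->; rewrite groupM.
  split; first exact: mem_orbit.
  rewrite /= act_fix //; rewrite eC rcoset_repr -eC in fC *; exact: fC.
exists ('C_G[x | to] :* a).
  by rewrite inE -rcosetE imset_f //= rcosetE -act_fix.
rewrite /=; have := mem_repr_rcoset ('C_G[x | to])%G a.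
case/rcosetP=> c /setIP[Gc cx] ->; rewrite actMin ?(subsetP sGD) //.
by rewrite (astab_act cx) ?set11.
Qed.

Lemma acts_subgroups : [acts G, on subgroups G | 'JG].
Proof.
apply/actsP=> a Ga K; rewrite !inE /=.
by rewrite -{1}(conjGid Ga) conjSg.
Qed.

Lemma subgroup_class_sub (C : subgroup_class) : class_rep C \subset G.
Proof.
have [_ sub _ _] := orbit_transversalP acts_subgroups.
by have := subsetP sub _ (valP C); rewrite inE.
Qed.

Lemma subgroup_class_ex (K : {group gT}) : K \subset G ->
  exists C : subgroup_class, K \in orbit 'JG G (class_rep C).
Proof.
move=> sKG; have [_ _ _ ex] := orbit_transversalP acts_subgroups.
have [|a Ga Xa] := ex K; first by rewrite inE.
by exists (exist _ ('JG K a)%act Xa); rewrite orbit_sym mem_orbit.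
Qed.

Lemma subgroup_class_inj (C D : subgroup_class) :
  (class_rep D \in orbit 'JG G (class_rep C)) = (D == C).
Proof.
have [_ _ inj _] := orbit_transversalP acts_subgroups.
by rewrite inj ?(valP C) ?(valP D) // eq_sym.
Qed.

Lemma eq_orbitJG (K L : {group gT}) :
  K \in orbit 'JG G L -> orbit 'JG G K = orbit 'JG G L.
Proof. exact: elimT (orbit_eqP (to:='JG) (G:=G) (x:=K) (y:=L)). Qed.

Lemma Gclass_class (K : {group gT}) (C : subgroup_class) :
  K \in orbit 'JG G (class_rep C) -> Gclass K = [ffun D => (D == C)%:R].
Proof.
move=> KC; apply/ffunP=> D; rewrite !ffunE.
by rewrite orbit_sym (eq_orbitJG KC) subgroup_class_inj.
Qed.

Lemma GclassJ (K : {group gT}) a : a \in G -> Gclass (K :^ a) = Gclass K.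
Proof.
move=> Ga; apply/ffunP=> D; rewrite !ffunE; congr (nat_of_bool _)%:R.
rewrite ![_ \in orbit _ _ (class_rep D)]orbit_sym.
by rewrite (@eq_orbitJG (K :^ a)%G K) // (mem_orbit 'JG).
Qed.

Lemma fix_rcosetsJ (K H : {group gT}) a : a \in G -> K \subset G -> H \subset G ->
  #|'Fix_(rcosets (K :^ a) G | 'Rs)(H)| = #|'Fix_(rcosets K G | 'Rs)(H)|.
Proof.
move=> Ga sKG sHG; have /esym := @fix_orbit [set: gT] _ 'Rs (K :* a) H (subsetT G) sHG.
have -> : 'C_G[K :* a | 'Rs] = K :^ a.
  rewrite -rcosetE astab1_act astab1Rs; apply/setIidPr.
  by rewrite -(conjGid Ga) conjSg.
move=> ->; congr #|_ :&: _|; rewrite -orbitRs; apply/orbit_eqP.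
by rewrite -rcosetE mem_orbit.
Qed.

Lemma rcosets_reps (K H : {group gT}) (C : subgroup_class) :
  H \subset G -> K \in orbit 'JG G (class_rep C) ->
  #|'Fix_(rcosets K G | 'Rs)(H)| = #|'Fix_(rcosets (class_rep C) G | 'Rs)(H)|.
Proof.
by move=> sHG /orbitP[a Ga <-]; rewrite /= fix_rcosetsJ // subgroup_class_sub.
Qed.

Lemma markD H : {morph mark H : x y / x + y}.
Proof.
move=> x y; rewrite /mark -big_split; apply: eq_bigr => C _ /=.
by rewrite !ffunE mulrDr.
Qed.

Lemma mark0 H : mark H 0 = 0.
Proof. by rewrite /mark big1 // => C _; rewrite ffunE mulr0. Qed.

Lemma markB H : {morph mark H : x y / x - y}.
Proof.
move=> x y; rewrite /mark -sumrB; apply: eq_bigr => C _ /=.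
by rewrite !ffunE mulrDr mulrN.
Qed.

HB.instance Definition _ H := GRing.isZmodMorphism.Build burnside int (mark H) (markB H).

Lemma mark_Gclass (H K : {group gT}) : H \subset G -> K \subset G ->
  mark H (Gclass K) = #|'Fix_(rcosets K G | 'Rs)(H)|%:Z.
Proof.
move=> sHG sKG; have [C KC] := subgroup_class_ex sKG.
rewrite (rcosets_reps sHG KC) (Gclass_class KC) /mark (bigD1 C) //= ffunE eqxx mulr1.
by rewrite big1 ?addr0 // => D /negPf nDC; rewrite ffunE nDC mulr0.
Qed.

Lemma mark_gset (H D : {group gT}) (T : finType) (to : action D T) (A : {set T}) :
  H \subset G -> [acts G, on A | to] ->
  mark H (gset_class to A) = #|'Fix_(A | to)(H)|%:Z.
Proof.
move=> sHG actsA; have sGD := acts_dom actsA.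
have [_ sXA inj ex] := orbit_transversalP actsA.
rewrite raddf_sum /=.
transitivity (\sum_(x in orbit_transversal to G A)
    #|'Fix_(orbit to G x | to)(H)|%:Z).
  by apply: eq_bigr => x Xx; rewrite mark_Gclass ?subsetIl // fix_orbit.
have -> : #|'Fix_(A | to)(H)| =
    (\sum_(y in A) (y \in 'Fix_to(H)))%N.
  by rewrite -sum1_card [RHS]big_mkcond [LHS]big_mkcond; apply: eq_bigr => y _; rewrite in_setI; do 2 case: (_ \in _).
rewrite (set_partition_big _ (orbit_partition actsA)) /=.
have -> : orbit to G @: A = orbit to G @: orbit_transversal to G A.
  apply/setP=> O; apply/imsetP/imsetP=> [[x Ax ->]|[x Xx ->]].
    have [a Ga Xa] := ex x Ax; exists (to x a) => //.
    by apply/esym/orbit_in_eqP; rewrite ?mem_orbit.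
  by exists x; rewrite ?(subsetP sXA).
rewrite [in RHS]big_imset /=; last first.
  move=> x y Xx Xy e; have: y \in orbit to G x by rewrite e orbit_refl.
  by rewrite inj // => /eqP.
rewrite -natz natr_sum; apply: eq_bigr => x _; rewrite natz; congr Posz.
by rewrite -sum1_card [RHS]big_mkcond [LHS]big_mkcond; apply: eq_bigr => y _; rewrite in_setI; do 2 case: (_ \in _).
Qed.

Lemma acts_pair (D : {group gT}) (T1 T2 : finType) (to1 : action D T1)
    (to2 : action D T2) A B :
  [acts G, on A | to1] -> [acts G, on B | to2] ->
  [acts G, on setX A B | pair_action to1 to2].
Proof.
move=> aA aB; have sGD := acts_dom aA.
apply/subsetP=> g Gg; rewrite !inE (subsetP sGD) //=.
apply/subsetP=> -[x y] /setXP[Ax By]; rewrite !inE /=.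
by rewrite (acts_act aA) ?(acts_act aB) ?Ax.
Qed.

Lemma fix_pair (D : {group gT}) (T1 T2 : finType) (to1 : action D T1)
    (to2 : action D T2) A B H :
  'Fix_(setX A B | pair_action to1 to2)(H) =
    setX 'Fix_(A | to1)(H) 'Fix_(B | to2)(H).
Proof.
apply/setP=> -[x y]; apply/setIP/setXP=> [[/setXP[Ax By] /afixP f]|[/setIP[Ax /afixP fx] /setIP[By /afixP fy]]].
  by split; apply/setIP; split=> //; apply/afixP=> h /f [].
split; first exact/setXP.
by apply/afixP=> h Hh /=; rewrite /pair_act /= fx ?fy.
Qed.

Lemma markM (H : {group gT}) : H \subset G ->
  {morph mark H : x y / burnside_mul x y >-> x * y}.
Proof.
move=> sHG x y; rewrite raddf_sum /= {2 3}/mark mulr_suml; apply: eq_bigr => C _.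
rewrite raddf_sum mulr_sumr; apply: eq_bigr => D _.
rewrite raddfMz /= mark_gset ?acts_pair ?actsRs_rcosets //.
by rewrite fix_pair cardsX -mulrzr intz PoszM; rewrite mulrACA.
Qed.

Lemma mark_inj x y : (forall H : {group gT}, H \subset G -> mark H x = mark H y) -> x = y.
Proof.
move=> eq_xy; apply/eqP; rewrite -subr_eq0; set z := x - y.
have {eq_xy} z0 (H : {group gT}) : H \subset G -> mark H z = 0.
  by move=> sHG; rewrite raddfB /= eq_xy // subrr.
apply/eqP/ffunP=> C; rewrite [RHS]ffunE; apply/eqP; apply: contraT => zC.
have [{zC}C zC maxC] := arg_maxnP (fun C : subgroup_class => #|class_rep C|) (zC : (fun C => z C != 0) C).
have := z0 _ (subgroup_class_sub C); rewrite /mark (bigD1 C) //= big1 => [|D nDC].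
  move/eqP; rewrite addr0 mulf_eq0 (negPf zC) orbF eqz_nat cards_eq0.
  move/eqP/setP/(_ (class_rep C : {set gT})); rewrite !inE => /negP[].
  apply/andP; split; first by apply/rcosetsP; exists 1%g; rewrite ?mulg1.
  by apply/subsetP=> a Ca; rewrite inE /= rcosetE rcoset_id.
have [-> | zD] := eqVneq (z D) 0; first by rewrite mulr0.
rewrite (_ : #|_| = 0%N) ?mul0r //; apply/eqP; rewrite cards_eq0; apply/negPn/negP.
case/set0Pn=> K /setIP[/rcosetsP[a Ga ->]]; rewrite sub_afixRs_norms => sCD.
case/negP: nDC; rewrite -subgroup_class_inj orbit_sym.
apply/orbitP; exists a => //; apply/val_inj/eqP; rewrite /= eq_sym eqEcard sCD cardJg.
exact: maxC.
Qed.

Lemma burnside_mulA : associative burnside_mul.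
Proof. by move=> x y z; apply: mark_inj => H sHG; rewrite !markM // mulrA. Qed.

Lemma burnside_mulC : commutative burnside_mul.
Proof. by move=> x y; apply: mark_inj => H sHG; rewrite !markM // mulrC. Qed.

Lemma mark1 (H : {group gT}) : H \subset G -> mark H (Gclass G) = 1.
Proof.
move=> sHG; rewrite mark_Gclass // rcosets_id.
rewrite (_ : _ :&: _ = [set (G : {set gT})]) ?cards1 //.
apply/setIidPl; rewrite sub1set; apply/afixP=> a Ha.
by rewrite /= rcosetE rcoset_id // (subsetP sHG).
Qed.

Lemma burnside_mul1 : left_id (Gclass G) burnside_mul.
Proof. by move=> x; apply: mark_inj => H sHG; rewrite markM // mark1 // mul1r. Qed.

Lemma burnside_mulDl : left_distributive burnside_mul +%R.
Proof. by move=> x y z; apply: mark_inj => H sHG; rewrite markD !markM // markD mulrDl. Qed.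

Lemma burnside_one_neq0 : Gclass G != 0.
Proof.
by apply/eqP=> /(congr1 (mark 1%G)); rewrite mark1 ?sub1G // raddf0.
Qed.

HB.instance Definition _ := GRing.Zmodule_isComNzRing.Build burnside
  burnside_mulA burnside_mulC burnside_mul1 burnside_mulDl burnside_one_neq0.

Lemma gset_classM (D : {group gT}) (T1 T2 : finType) (to1 : action D T1)
    (to2 : action D T2) (A : {set T1}) (B : {set T2}) :
  [acts G, on A | to1] -> [acts G, on B | to2] ->
  gset_class (pair_action to1 to2) (setX A B) =
    gset_class to1 A * gset_class to2 B.
Proof.
move=> aA aB; apply: mark_inj => H sHG.
by rewrite [RHS]markM // !mark_gset ?acts_pair // fix_pair cardsX PoszM.
Qed.

End Burnside.

Section PartialBurnside.

Variables (gT : finGroupType) (G : {group gT}).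

Record collection (D : {set {group gT}}) : Prop := Collection {
  collection_sub : {in D, forall H : {group gT}, H \subset G};
  collection_full : G \in D;
  collection_cap : {in D &, forall H K : {group gT}, (H :&: K)%G \in D};
  collection_conj : {in D & G, forall (H : {group gT}) g, (H :^ g)%G \in D}
}.

(* Omega(G, D), as a subset of Omega(G); a subring when D is a collection. *)
Definition partial_burnside (D : {set {group gT}}) (x : burnside G) : Prop :=
  exists c : {group gT} -> int, x = \sum_(H in D) Gclass G H *~ c H.

Section Subring.

Variable D : {set {group gT}}.

Lemma partial_burnside_class (H : {group gT}) :
  H \in D -> partial_burnside D (Gclass G H).
Proof.
move=> DH; exists (fun K => (K == H)%:R); rewrite (bigD1 H) //= eqxx mulr1z.
by rewrite big1 ?addr0 // => K /andP[_ /negPf->]; rewrite mulr0z.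
Qed.

Lemma partial_burnside0 : partial_burnside D 0.
Proof. by exists (fun=> 0); rewrite big1 // => H _; rewrite mulr0z. Qed.

Lemma partial_burnsideD x y :
  partial_burnside D x -> partial_burnside D y -> partial_burnside D (x + y).
Proof.
move=> [a ->] [b ->]; exists (fun H => a H + b H).
by rewrite -big_split; apply: eq_bigr => H _; rewrite mulrzDr.
Qed.

Lemma partial_burnsideMz x n : partial_burnside D x -> partial_burnside D (x *~ n).
Proof.
move=> [a ->]; exists (fun H => a H * n); rewrite mulrz_suml.
by apply: eq_bigr => H _; rewrite mulrzA.
Qed.

Lemma partial_burnsideN x : partial_burnside D x -> partial_burnside D (- x).
Proof. by move=> Dx; rewrite -mulrN1z; apply: partial_burnsideMz. Qed.

Lemma partial_burnside_sum (I : Type) (r : seq I) (P : pred I) (F : I -> burnside G) :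
  (forall i, P i -> partial_burnside D (F i)) ->
  partial_burnside D (\sum_(i <- r | P i) F i).
Proof.
move=> DF; elim/big_ind: _ => //; first exact: partial_burnside0.
exact: partial_burnsideD.
Qed.

Hypothesis collD : collection D.

Lemma partial_burnside1 : partial_burnside D 1.
Proof. exact/partial_burnside_class/collection_full. Qed.

Lemma partial_burnsideM x y :
  partial_burnside D x -> partial_burnside D y -> partial_burnside D (x * y).
Proof.
have coset_gset (H : {group gT}) : H \in D ->
  Gclass G H = gset_class G 'Rs (rcosets H G).
  move=> /(collection_sub collD) sHG; apply: mark_inj => K sKG.
  by rewrite mark_Gclass // mark_gset // actsRs_rcosets.
move=> [a ->] [b ->]; rewrite mulr_suml; apply: partial_burnside_sum => H DH.
rewrite mulr_sumr; apply: partial_burnside_sum => K DK.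
rewrite mulrzAr mulrzAl; do 2 apply: partial_burnsideMz.
rewrite !coset_gset // -gset_classM ?actsRs_rcosets //.
apply: partial_burnside_sum => -[X Y].
have aHK : [acts G, on setX (rcosets H G) (rcosets K G) | pair_action 'Rs 'Rs].
  by apply: acts_pair; apply: actsRs_rcosets.
have [_ /subsetP sX _ _] := orbit_transversalP aHK.
case/sX/setXP=> /rcosetsP[g Gg ->] /rcosetsP[h Gh ->].
suff -> : 'C_G[(H :* g, K :* h) | pair_action 'Rs 'Rs]%G = (H :^ g :&: K :^ h)%G.
  by apply: partial_burnside_class; rewrite !(collection_cap, collection_conj).
have sHg : H :^ g \subset G by rewrite -(conjGid Gg) conjSg (collection_sub collD).
have astabR (L : {group gT}) z t : ('Rs (L :* z) t == L :* z)%act = (t \in L :^ z).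
  have := congr1 (fun A : {set gT} => t \in A) (astab1_act 'Rs (L : {set gT}) z).
  by rewrite astab1Rs /= rcosetE => <-; rewrite !inE sub1set inE.
apply/val_inj/setP=> z; rewrite /= !inE sub1set !inE /= xpair_eqE !astabR.
by have [/(subsetP sHg)->|] := boolP (z \in H :^ g); rewrite ?andbF.
Qed.

End Subring.

End PartialBurnside.

(* The group of units of the subring A of R, as a subset of R. *)
Definition units (R : comNzRingType) (A : R -> Prop) (x : R) : Prop :=
  A x /\ exists2 y, A y & x * y = 1.

(* The subgroup generated by a set X of units of R. *)
Inductive generated_units (R : comNzRingType) (X : R -> Prop) : R -> Prop :=
| generated_units_mem x : X x -> generated_units X x
| generated_units1 : generated_units X 1
| generated_unitsM x y :
    generated_units X x -> generated_units X y -> generated_units X (x * y)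
| generated_unitsV x y :
    generated_units X x -> x * y = 1 -> generated_units X y.

Definition has_card (T : eqType) (A : T -> Prop) (n : nat) : Prop :=
  exists s : seq T, [/\ uniq s, size s = n & forall x, x \in s <-> A x].

Section Coxeter.

Variable gT : finGroupType.

(* W = < S | (s * t) ^+ m(s, t) = 1 >, where m(s, t) is the order of s * t;   *)
(* the presentation is expressed by its universal property, among all groups. *)
Record coxeter_system (W : {group gT}) (S : {set gT}) : Prop := CoxeterSystem {
  coxeter_gen : <<S>> = W :> {set gT};
  coxeter_invol : {in S, forall s, #[s] = 2%N};
  coxeter_presentation : forall (H : groupType) (f : gT -> H),
    {in S &, forall s t, ((f s * f t) ^+ #[s * t] = 1)%g} ->
    exists2 h : gT -> H,
      {in W &, {morph h : x y / (x * y)%g}} & {in S, h =1 f}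
}.

Definition coxeter_graph (S : {set gT}) : rel gT :=
  [rel s t | [&& s \in S, t \in S & (2 < #[(s * t)%g])%N]].

(* The generating sets S_t of the irreducible components (<<S_t>>, S_t): the  *)
(* vertex sets of the connected components of the Coxeter graph.              *)
Definition coxeter_components (S : {set gT}) : {set {set gT}} :=
  equivalence_partition (connect (coxeter_graph S)) S.

Definition parabolics (W : {group gT}) (S : {set gT}) : {set {group gT}} :=
  [set (<<J>> :^ w)%G | J in powerset S, w in W].

Definition sign_unit (W : {group gT}) (S : {set gT}) : burnside W :=
  \sum_(J in powerset S) (-1) ^+ #|J| * Gclass W <<J>>.

End Coxeter.

Section ComponentEmbedding.

Variables (gT : finGroupType) (W : {group gT}) (l : nat).
Variables (Wc : 'I_l -> {group gT}) (j : 'I_l).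

(* W_1 x ... x W_(j-1) x H x W_(j+1) x ... x W_l *)
Definition replace_factor (H : {group gT}) : {group gT} :=
  (\prod_(i < l) (if i == j then H else Wc i))%G.

(* f_j, as the linear map sending [W_j/H] to [W/replace_factor H]; this does  *)
(* not depend on the chosen representatives, see component_embedding_class.   *)
Definition component_embedding (x : burnside (Wc j)) : burnside W :=
  \sum_(C : subgroup_class (Wc j)) Gclass W (replace_factor (class_rep C)) *~ x C.

Hypothesis sWcW : forall i, Wc i \subset W.
Hypothesis cWc : forall i, i != j -> Wc j \subset 'C(Wc i).

Lemma component_embedding_class (H : {group gT}) : H \subset Wc j ->
  component_embedding (Gclass (Wc j) H) = Gclass W (replace_factor H).
Proof.
move=> /subgroup_class_ex[C HC]; rewrite (Gclass_class HC).
rewrite /component_embedding (bigD1 C) //= ffunE eqxx mulr1z big1 => [|D].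
  case/orbitP: HC => a Wa <-; rewrite addr0 -(GclassJ _ (subsetP (sWcW j) a Wa)).
  congr Gclass; rewrite /replace_factor (big_morph (fun K => (K :^ a)%G) (id1 := 1%G) (op1 := @joinG gT)).
  - apply: eq_bigr => i _; case: eqP => [//|/eqP nij]; apply: val_inj => /=.
    by apply: normP; apply: (subsetP (cent_sub _)); apply: (subsetP (cWc nij)).
  - by move=> A B; apply: val_inj; rewrite /= conjYg.
  - by apply: val_inj; rewrite /= conjs1g.
by rewrite ffunE => /negPf->; rewrite mulr0z.
Qed.

End ComponentEmbedding.

Arguments component_embedding {gT} W {l} Wc j x.

(* Main.v *)
(* An element of Omega(W, P_W) is determined by its marks at the subgroups      *)
(* Q = Q_1 x ... x Q_l with Q_t <= W_t, and letting one factor Q_t vary gives    *)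
(* the marks of an element of Omega(W_t, P_t). For a unit all marks are 1 or -1, *)
(* so by hypothesis it is, along each coordinate line, a sign times 1 or         *)
(* eps_t. Which of the two occurs does not depend on the line: for simple        *)
(* reflections r of W_t and s of W_j, t != j, a product of two differences       *)
(* shows that phi_(1,1) - phi_(<r>,1) - phi_(1,<s>) + phi_(<r>,<s>) is divisible *)
(* by 4, so the product of these four signs is 1. Hence every unit is a sign     *)
(* times a product of f_t(eps_t).                                                *)
(*                                                                               *)
(* That eps is a unit comes from the presentation. The action of W on signed     *)
(* reflections gives inversion sets, hence the length function and the exchange  *)
(* condition, and then Kilmoyer's theorem W_K :&: W_J^e = W_(K :&: J^e) for      *)
(* minimal double coset representatives e. If H <= W_K with K minimal, the       *)
(* cosets of W_J fixed by H correspond to the J-minimal d such that d is minimal *)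
(* in d W_K and d K d^-1 is contained in J; summing (-1)^|J| over J leaves only  *)
(* the d for which d K d^-1 is the set of left ascents, and d = w_0 w_K is the   *)
(* only one, so that phi_H(eps) = (-1)^|K|.                                      *)

From HB Require Import structures.
Require Import Defs.
From mathcomp Require Import all_boot all_order all_algebra all_fingroup.
From mathcomp Require Import zify ring pgroup sylow.

Set Implicit Arguments.
Unset Strict Implicit.
Unset Printing Implicit Defensive.

Import GroupScope GRing.Theory.

(** * Inversion sets *)

(** Each f_t(eps_t) squares to 1, so a sign times the product of the f_t(eps_t) over a set of
    components ([signed_product]) is a unit. The mark at the trivial group recovers the sign, and
    the marks at the groups generated by one simple reflection recover the set, so there are 2 * 2^l
    such units. It remains to see that every unit has this form.

    By [mark_proj], an element of Omega(W, P_W) is determined by its marks at product subgroups, so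
    a unit becomes a function with values 1 and -1 on a grid with one axis per component. On a line
    in direction t this function gives the marks of an element of Omega(W_t, P_t) ([mark_line]),
    which must be a sign times 1 or eps_t ([component_units]). On a square spanned by two simple
    reflections from different components the product of the four signs is 1 ([mark_plane]), so
    whether eps_t occurs is the same on all parallel lines. Hence a unit whose marks are 1 at the
    trivial group and on the axes is 1 ([grid_const], [unit_normalized_eq1]), and every unit reaches
    this form after multiplication by a suitable signed product.

    That the sign unit is a unit with the stated marks is derived from the presentation:
    [refl_perm_rel] gives the action on signed reflections, [word_exchange] the exchange condition,
    [kilmoyer] the intersections of parabolics, and [mark_sign_unit_min] the marks by an alternating
    sum over intervals of subsets of S. *)

Section ReflectionPermutations.

Variable gT : finGroupType.

(** The action of a simple reflection on signed reflections, extended to all of [gT * bool] so that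
    the set of reflections need not be singled out. The sign flips only at s itself. *)
Definition refl_fun (s : gT) (p : gT * bool) := (p.1 ^ s, p.2 (+) (p.1 == s)).

Lemma refl_fun_inj s : injective (refl_fun s).
Proof.
by move=> [x a] [y b] [/conjg_inj-> /(can_inj (addbK _))->].
Qed.

Definition refl_perm s : {perm gT * bool} := perm (@refl_fun_inj s).

Lemma refl_permE s x e : refl_perm s (x, e) = (x ^ s, e (+) (x == s)).
Proof. by rewrite permE. Qed.

(** The 2n letters of s t s t ... flip the sign of x when x is, in turn, (s t)^k s for k < 2n. The
    conjugates are brought to this form because s inverts s t ([qV]). *)
Lemma refl_perm_pow (s t x : gT) e n : s ^+ 2 = 1 -> t ^+ 2 = 1 ->
  ((refl_perm s * refl_perm t) ^+ n) (x, e) =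
    (x ^ (s * t) ^+ n, e (+) odd (\sum_(k < n.*2) (x == (s * t) ^+ k * s)%g)).
Proof.
move=> s2 t2; have sV : s^-1 = s by apply/eqP; rewrite eq_invg_mul -expg2 s2.
have tV : t^-1 = t by apply/eqP; rewrite eq_invg_mul -expg2 t2.
have qV k : (s * t) ^+ k * s = s * (s * t) ^- k.
  elim: k => [|k IHk]; first by rewrite !expg0 invg1 mul1g mulg1.
  by rewrite {1}expgS -mulgA IHk expgSr 2!invMg sV tV !mulgA.
elim: n => [|n IHn]; first by rewrite !expg0 perm1 conjg1 big_ord0 addbF.
rewrite expgSr permM IHn permM !refl_permE doubleS !big_ord_recr /= -!conjgM.
rewrite expgSr !mulgA; congr (_, _).
rewrite !oddD -!addbA; congr (_ (+) (_ (+) _)).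
have -> : (x ^ (s * t) ^+ n == s) = (x == (s * t) ^+ n.*2 * s).
  rewrite -(inj_eq (@conjg_inj _ ((s * t) ^- n))) conjgK conjgE invgK qV.
  by rewrite mulgA qV -mulgA -invMg -expgD addnn -qV.
have -> : (x ^ ((s * t) ^+ n * s) == t) = (x == (s * t) ^+ n.*2.+1 * s).
  rewrite -(inj_eq (@conjg_inj _ ((s * t) ^+ n * s)^-1)) conjgK conjgE invgK.
  have -> : (s * t) ^+ n * s * (t * ((s * t) ^+ n * s)^-1) = (s * t) ^+ n.+1 * ((s * t) ^+ n * s)^-1.
    by rewrite expgSr !mulgA.
  rewrite qV invMg invgK sV mulgA -expgD.
  by rewrite addSn addnn.
by rewrite !oddb.
Qed.

(** With n the order of s t, the 2n elements (s t)^k s run twice through the same n values, so all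
    sign changes cancel. *)
Lemma refl_perm_rel (s t : gT) : s ^+ 2 = 1 -> t ^+ 2 = 1 ->
  (refl_perm s * refl_perm t) ^+ #[s * t] = 1.
Proof.
move=> s2 t2; apply/permP=> -[x e]; rewrite refl_perm_pow // perm1 expg_order conjg1.
rewrite -addnn big_split_ord /= oddD.
under [X in _ (+) odd X]eq_bigr => k _ do rewrite expgD expg_order mul1g.
by rewrite addbb addbF.
Qed.

End ReflectionPermutations.

Section Words.
Variables (gT : finGroupType).
Implicit Types (J : {set gT}) (ws : seq gT).

Definition wprod ws : gT := foldr mulg 1 ws.

Lemma wprod_cat ws1 ws2 : wprod (ws1 ++ ws2) = wprod ws1 * wprod ws2.
Proof. by elim: ws1 => [|s ws IH] /=; rewrite ?mul1g // IH mulgA. Qed.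

Lemma wprod_mem J ws : {subset ws <= J} -> wprod ws \in <<J>>.
Proof.
elim: ws => [|s ws IH] sJ /=; first exact: group1.
rewrite groupM ?IH ?mem_gen ?sJ ?mem_head // => x xw.
by rewrite sJ // inE xw orbT.
Qed.

Lemma wprod_ex J w : w \in <<J>> -> exists2 ws, {subset ws <= J} & w = wprod ws.
Proof.
case/gen_prodgP=> n [c Jc ->]; exists [seq c i | i <- index_enum 'I_n].
  by move=> x /mapP[i _ ->].
by elim: (index_enum _) => [|i r IH]; rewrite ?big_nil // big_cons IH.
Qed.
End Words.

(** When B contains some b outside A, adding or removing b is a sign-reversing involution of the
    interval. *)
Lemma sign_sum_interval (T : finType) (A B : {set T}) :
  (\sum_(J : {set T} | (A \subset J) && (J \subset B)) (-1) ^+ #|J| =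
     (-1) ^+ #|A| *+ (A == B) :> int)%R.
Proof.
have [->|neqAB] := eqVneq A B.
  rewrite (big_pred1 B) // => J; apply/andP/eqP=> [[sBJ sJB]|->]; last by rewrite subxx.
  by apply/eqP; rewrite eqEsubset sJB.
rewrite mulr0n; have [sAB|nsAB] := boolP (A \subset B); last first.
  rewrite big_pred0 // => J; apply/negP=> /andP[sAJ sJB].
  by rewrite (subset_trans sAJ) in nsAB.
have /properP[_ [b Bb nAb]] : A \proper B by rewrite properEneq neqAB.
pose f (J : {set T}) := if b \in J then J :\ b else b |: J.
have fK : involutive f.
  move=> J; rewrite /f; case: (boolP (b \in J)) => Jb /=; first by rewrite !inE eqxx /= setD1K.
  by rewrite setU11 setU1K.
have sgn_f J : ((-1) ^+ #|f J| = - (-1) ^+ #|J| :> int)%R.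
  rewrite /f; case: ifPn => Jb.
    by rewrite [in RHS](cardsD1 b) Jb add1n exprS mulN1r opprK.
  by rewrite cardsU1 Jb add1n exprS mulN1r.
set s := (\sum_(_ | _) _)%R; have : (s = - s)%R.
  rewrite {1}/s (reindex_inj (inv_inj fK)) /= -sumrN.
  apply: eq_big => [J|J _]; last exact: sgn_f.
  rewrite /f; case: ifPn => Jb; first by rewrite subsetD1 nAb andbT subDset (setUidPr _) ?sub1set.
  rewrite subUset sub1set Bb /=; congr (_ && _).
  apply/idP/idP=> [sAJ|/subset_trans->//]; last exact: subsetUr.
  apply/subsetP=> x Ax; move: (subsetP sAJ x Ax); rewrite !inE => /orP[/eqP xb|//].
  by rewrite xb (negPf nAb) in Ax.
by move/eqP; rewrite eq_sym Num.Theory.eqNr => /eqP.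
Qed.

Section Inversions.

Variables (gT : finGroupType) (W : {group gT}) (S : {set gT}).
Variable h : gT -> {perm gT * bool}.
Hypothesis gen_SW : <<S>> = W :> {set gT}.
Hypothesis invol : {in S, forall s, #[s] = 2}.
Hypothesis hM : {in W &, {morph h : x y / x * y}}.
Hypothesis hS : {in S, h =1 @refl_perm gT}.

Implicit Types (J K : {set gT}) (s t u v w x : gT) (ws : seq gT).

(* On a word s_1 ... s_n for w, the bit counts modulo 2 the occurrences of x
   among the reflections s_1 ... s_i ... s_1. *)
Definition inversions w := [set x | (h w (x, false)).2].
(** Counting inversions avoids minimising over words; [len_word] and [reduced_word] show that this
    is the length of a shortest word. *)
Definition len w := #|inversions w|.

Lemma simple_mem s : s \in S -> s \in W.
Proof. by move=> Ss; rewrite -gen_SW mem_gen. Qed.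

Lemma simpleV s : s \in S -> s^-1 = s.
Proof. by move=> /invol s2; apply/eqP; rewrite eq_invg_mul -expg2 -s2 expg_order. Qed.

Lemma simple_sq s : s \in S -> s * s = 1.
Proof. by move=> Ss; rewrite -{1}(simpleV Ss) mulVg. Qed.

Lemma gen_sub_W J : J \subset S -> <<J>> \subset W.
Proof. by move=> sJS; rewrite -gen_SW genS. Qed.

Lemma hom1 : h 1 = 1.
Proof. by apply: (mulgI (h 1)); rewrite -hM ?mulg1 ?group1. Qed.

Lemma hom_act w x e : w \in W -> h w (x, e) = (x ^ w, e (+) (x \in inversions w)).
Proof.
rewrite -gen_SW => /wprod_ex[ws sJ ->]; rewrite inE.
elim: ws sJ x e => [|s ws IH] sJ x e /=.
  by rewrite hom1 !perm1 conjg1 addbF.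
have Ss : s \in S by rewrite sJ ?mem_head.
have sws : {subset ws <= S} by move=> y yw; rewrite sJ // inE yw orbT.
have wW : wprod ws \in W by rewrite -gen_SW wprod_mem.
rewrite (hM (simple_mem Ss) wW) !permM (hS Ss) !refl_permE [LHS]IH // [in RHS]IH //= conjgM.
by congr (_, _); rewrite addbA.
Qed.

(** The cocycle rule: N(uv) is the symmetric difference of N(u) and u N(v) u^-1. The length
    computations below rest on it. *)
Lemma inversionsM u v x : u \in W -> v \in W ->
  (x \in inversions (u * v)) = (x \in inversions u) (+) (x ^ u \in inversions v).
Proof.
move=> Wu Wv; rewrite [LHS]inE hM // permM (hom_act _ _ Wu) addFb.
by rewrite hom_act.
Qed.

Lemma inversions1 : inversions 1 = set0.
Proof. by apply/setP=> x; rewrite !inE hom1 perm1. Qed.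

Lemma inversions_simple s : s \in S -> inversions s = [set s].
Proof. by move=> Ss; apply/setP=> x; rewrite !inE hS // refl_permE. Qed.

Lemma inversionsV w x : w \in W -> (x \in inversions w^-1) = (x ^ w^-1 \in inversions w).
Proof.
move=> Ww; have := inversionsM x (groupVr Ww) Ww.
rewrite mulVg inversions1 inE => /esym/eqP; by case: (_ \in _); case: (_ \in _).
Qed.

Lemma len1 : len 1 = 0%N.
Proof. by rewrite /len inversions1 cards0. Qed.

Lemma lenV w : w \in W -> len w^-1 = len w.
Proof.
move=> Ww; rewrite /len -(cardJg (inversions w) w).
by apply: eq_card => x; rewrite inversionsV // mem_conjg.
Qed.

Lemma len_mul_simple_r w s : w \in W -> s \in S ->
  len (w * s) = if s ^ w^-1 \in inversions w then (len w).-1 else (len w).+1.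
Proof.
move=> Ww Ss; set t := s ^ w^-1.
have E x : (x \in inversions (w * s)) = (x \in inversions w) (+) (x == t).
  rewrite inversionsM ?(simple_mem Ss) // (inversions_simple Ss) in_set1; congr (_ (+) _).
  by rewrite /t; apply/eqP/eqP=> [<-|->]; rewrite ?conjgK ?conjgKV.
case: ifPn => tw.
  rewrite /len (cardsD1 t (inversions w)) tw add1n /=; apply: eq_card => x; rewrite E in_setD1.
  by case: eqP => [->|]; rewrite ?tw ?addbF.
have := cardsU1 t (inversions w); rewrite tw add1n => <-; apply: eq_card => x; rewrite E in_setU1.
by case: eqP => [->|]; rewrite ?(negPf tw) ?addbF.
Qed.

(** Strong exchange: x is one of the reflections s_1 ... s_i ... s_1 of the word, and left
    multiplication by it deletes the letter s_i. The word may be non-reduced. *)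
Lemma word_exchange ws x : {subset ws <= S} -> x \in inversions (wprod ws) ->
  exists ws', [/\ size ws = (size ws').+1, {subset ws' <= ws} & x * wprod ws = wprod ws'].
Proof.
elim: ws x => [|s ws IH] x sS /=; first by rewrite inversions1 inE.
have Ss : s \in S by rewrite sS ?mem_head.
have sws : {subset ws <= S} by move=> y yw; rewrite sS // inE yw orbT.
have wW : wprod ws \in W by rewrite -gen_SW wprod_mem.
rewrite inversionsM ?(simple_mem Ss) // (inversions_simple Ss) in_set1; have [->|_] /= := eqVneq x s.
  by exists ws; split=> // [y yw|]; rewrite ?inE ?yw ?orbT // mulgA simple_sq ?mul1g.
case/IH=> // ws' [sz sub e]; exists (s :: ws'); split=> /=; first by rewrite sz.
  by move=> y; rewrite !inE => /orP[->//|/sub->]; rewrite orbT.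
by rewrite -e conjgE (simpleV Ss) !mulgA (simple_sq Ss) mul1g.
Qed.

Lemma len_mul_simple_l s w : w \in W -> s \in S ->
  len (s * w) = if s \in inversions w then (len w).-1 else (len w).+1.
Proof.
move=> Ww Ss; rewrite -[LHS]lenV ?groupM ?(simple_mem Ss) // invMg (simpleV Ss) len_mul_simple_r ?groupV // lenV //.
by rewrite inversionsV // invgK conjgK.
Qed.

Lemma len_word ws : {subset ws <= S} -> len (wprod ws) <= size ws.
Proof.
elim: ws => [|s ws IH] sS /=; first by rewrite len1.
have sS' : {subset ws <= S} by move=> x xw; rewrite sS // inE xw orbT.
rewrite len_mul_simple_l ?sS ?mem_head -?gen_SW ?wprod_mem //.
have := IH sS'; case: ifP => _ // le.
exact: leq_trans (leq_pred _) (leqW le).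
Qed.

Lemma word_shorten ws : {subset ws <= S} -> len (wprod ws) = size ws \/
  exists ws', [/\ {subset ws' <= ws}, wprod ws' = wprod ws & size ws' < size ws].
Proof.
elim: ws => [|s ws IH] sS /=; first by left; rewrite len1.
have Ss : s \in S by rewrite sS ?mem_head.
have sws : {subset ws <= S} by move=> y yw; rewrite sS // inE yw orbT.
have wW : wprod ws \in W by rewrite -gen_SW wprod_mem.
have sub_cons ws' : {subset ws' <= ws} -> {subset s :: ws' <= s :: ws}.
  by move=> sub y; rewrite !inE => /orP[->//|/sub->]; rewrite orbT.
have [e|[ws' [sub e lt]]] := IH sws; last first.
  by right; exists (s :: ws'); rewrite /= e; split=> //; apply: sub_cons.
rewrite len_mul_simple_l //; case: ifPn => [sw|_]; last by left; rewrite e.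
have [ws' [sz sub e']] := word_exchange sws sw.
right; exists ws'; split=> //; last by rewrite sz ltnS leqW.
by move=> y /sub yw; rewrite inE yw orbT.
Qed.

(** Shortening a word only deletes letters, so a word in J can be reduced within J; the length on W
    therefore restricts to the length on <<J>>. *)
Lemma reduced_word J w : J \subset S -> w \in <<J>> ->
  exists ws, [/\ {subset ws <= J}, w = wprod ws & size ws = len w].
Proof.
move=> sJS /wprod_ex[ws sJ ->] {w}.
elim: {ws}_.+1 {-2}ws (ltnSn (size ws)) sJ => // n IH ws; rewrite ltnS => ltn sJ.
have [x /sJ/(subsetP sJS)//|e|[ws' [sub <- lt]]] := @word_shorten ws.
  by exists ws.
apply: IH; first exact: leq_trans ltn.
by move=> y /sub/sJ.
Qed.

Lemma gen_subW J w : J \subset S -> w \in <<J>> -> w \in W.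
Proof. by move=> /gen_sub_W /subsetP; apply. Qed.

Lemma len_eq1 J w : J \subset S -> w \in <<J>> -> len w = 1%N -> w \in J.
Proof.
move=> sJS Jw; have [[|s [|? ?]] [sJ -> //= <-] //=] := reduced_word sJS Jw.
by rewrite mulg1 sJ ?mem_head.
Qed.

Lemma len_eq0 w : w \in W -> len w = 0%N -> w = 1.
Proof.
rewrite -gen_SW => Sw; have [[|? ?] [_ -> //= <-] //] := reduced_word (subxx S) Sw.
Qed.

Lemma len_simple s : s \in S -> len s = 1%N.
Proof. by move=> Ss; rewrite /len inversions_simple ?cards1. Qed.

Lemma simple_gen J s : J \subset S -> s \in S -> s \in <<J>> -> s \in J.
Proof. by move=> sJS Ss Js; apply: len_eq1 (len_simple Ss). Qed.

Lemma descent_left J w : J \subset S -> w \in <<J>> -> w != 1 ->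
  exists2 s, s \in J & len (s * w) < len w.
Proof.
move=> sJS Jw; have [[|s ws] [sJ -> sz]] := reduced_word sJS Jw; first by rewrite eqxx.
move=> _; have Js : s \in J by rewrite sJ ?mem_head.
have Ss := subsetP sJS _ Js; exists s => //.
rewrite -sz /= mulgA (simple_sq Ss) mul1g ltnS len_word // => x xw.
by apply: (subsetP sJS); rewrite sJ // inE xw orbT.
Qed.

Lemma descent_right J w : J \subset S -> w \in <<J>> -> w != 1 ->
  exists2 s, s \in J & len (w * s) < len w.
Proof.
move=> sJS Jw w1; have Ww := gen_subW sJS Jw.
have w1V : w^-1 != 1 by rewrite invg_eq1.
have [s Js lt] := descent_left sJS (groupVr Jw) w1V.
have Ss := subsetP sJS _ Js.
by exists s => //; rewrite -(@lenV (w * s)) ?groupM ?(simple_mem Ss) // invMg (simpleV Ss) -(lenV Ww).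
Qed.

Lemma inversions_gen J v x : J \subset S -> v \in <<J>> -> x \in inversions v -> x \in <<J>>.
Proof.
move=> sJS /wprod_ex[ws sJ ->] xv.
have [y /sJ/(subsetP sJS)//|//|ws' [_ sub e]] := @word_exchange ws x.
rewrite -(mulgK (wprod ws) x) e groupM ?groupV ?wprod_mem // => y /sub; exact: sJ.
Qed.

Lemma inversions_lt w x : w \in W -> x \in inversions w -> len (x * w) < len w.
Proof.
rewrite -gen_SW => /(reduced_word (subxx S))[ws [sS -> sz]] xv.
have [ws' [sz' sub ->]] := word_exchange sS xv.
by rewrite -sz sz' ltnS len_word // => y /sub/sS.
Qed.

(** * Minimal coset representatives and Kilmoyer's theorem *)

Definition left_min J d := [forall u in <<J>>, len d <= len (u * d)].
Definition right_min K d := left_min K d^-1.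

(** The sets N(u) and u N(d) u^-1 are disjoint: a common element would give an inversion of d lying
    in <<J>>, and multiplying by it would shorten d inside its coset. *)
Lemma lenM_min J d u : J \subset S -> d \in W -> left_min J d -> u \in <<J>> ->
  len (u * d) = len u + len d.
Proof.
move=> sJS Wd /forall_inP dmin Ju; have Wu := gen_subW sJS Ju.
rewrite /len -(cardJg (inversions d) u^-1) -cardsUI.
rewrite (_ : _ :&: _ = set0) ?cards0 ?addn0.
  apply: eq_card => x; rewrite inversionsM // in_setU mem_conjgV.
  case: (boolP (x \in _)) => //= xu; apply/negP => xd.
  have Jx := inversions_gen sJS Ju xu.
  have:= dmin _ (groupJ Jx Ju); rewrite leqNgt inversions_lt //.
apply/setP=> x; rewrite in_setI in_set0 mem_conjgV; apply/negbTE/negP => /andP[xu xd].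
have Jx := inversions_gen sJS Ju xu.
by have:= dmin _ (groupJ Jx Ju); rewrite leqNgt inversions_lt.
Qed.

Lemma lenM_rmin K d u : K \subset S -> d \in W -> right_min K d -> u \in <<K>> ->
  len (d * u) = len d + len u.
Proof.
move=> sKS Wd dmin Ku; have Wu := gen_subW sKS Ku.
rewrite -[LHS]lenV ?groupM // invMg (@lenM_min K) ?groupV //.
by rewrite !lenV // addnC.
Qed.

Lemma coset_min J w : exists2 u, u \in <<J>> & left_min J (u * w).
Proof.
have [u Ju umin] := arg_minnP (fun u => len (u * w)) (group1 <<J>>).
exists u => //; apply/forall_inP=> v Jv; rewrite mulgA; exact: umin (groupM Jv Ju).
Qed.

(** Write d = u^-1 d' with d' minimal in the coset. Lengths add there, so a left descent of u^-1 in
    J would also be one of d. *)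
Lemma left_minP J d : J \subset S -> d \in W ->
  reflect {in J, forall s, len d < len (s * d)} (left_min J d).
Proof.
move=> sJS Wd; apply: (iffP idP) => [dmin s Js | asc].
  have Ss := subsetP sJS _ Js.
  by rewrite (lenM_min sJS Wd dmin) ?mem_gen // (len_simple Ss) add1n.
have [u Ju dmin] := coset_min J d; have Wu := gen_subW sJS Ju.
have [u1|u1] := eqVneq u 1; first by rewrite -[d]mul1g -u1.
have [||s Js lt] := @descent_left J u^-1 sJS; rewrite ?groupV ?invg_eq1 //.
have Ss := subsetP sJS _ Js.
have := asc s Js; have Wud := groupM Wu Wd.
have -> : len d = len u^-1 + len (u * d).
  by rewrite -(lenM_min sJS Wud dmin) ?groupV // mulKg.
have -> : s * d = s * u^-1 * (u * d) by rewrite -mulgA mulKg.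
rewrite (lenM_min sJS Wud dmin (groupM (mem_gen Js) (groupVr Ju))).
by rewrite ltn_add2r ltnNge ltnW.
Qed.

(* If [r = s'^(e^-1)] is the reflection removed from [v * e = e * w] by a right
   descent [s'] of [w], the exchange condition puts [r] in <<J>>, and comparing
   the lengths of [r * e = e * s'] makes it simple. *)
Lemma kilmoyer J K e : J \subset S -> K \subset S -> e \in W ->
  left_min J e -> right_min K e ->
  <<K>> :&: <<J>> :^ e \subset <<K :&: J :^ e>>.
Proof.
move=> sJS sKS We lmin rmin; apply/subsetP=> w /setIP[].
elim: {w}_.+1 {-2}w (ltnSn (len w)) => // n IH w; rewrite ltnS => ltn Kw.
have Ww := gen_subW sKS Kw.
have [-> _|w1] := eqVneq w 1; first exact: group1.
rewrite mem_conjg => Jv; set v := w ^ e^-1 in Jv.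
have Wv := gen_subW sJS Jv.
have ve : v * e = e * w by rewrite /v conjgE invgK !mulgA mulgKV.
have [s Ks lt] := descent_right sKS Kw w1.
have Ss := subsetP sKS _ Ks; have Ws := simple_mem Ss.
have Es : len (e * s) = (len e).+1 by rewrite (lenM_rmin sKS We rmin (mem_gen Ks)) (len_simple Ss) addn1.
have tin : s ^ (v * e)^-1 \in inversions (v * e).
  have := len_mul_simple_r (groupM Wv We) Ss; case: ifP => //= _.
  rewrite ve -mulgA (lenM_rmin sKS We rmin Kw).
  rewrite (lenM_rmin sKS We rmin (groupM Kw (mem_gen Ks))) => E.
  by move: lt; rewrite -(ltn_add2l (len e)) E ltnNge leqnSn.
have Jr : s ^ e^-1 \in <<J>>.
  move: tin; rewrite inversionsM // invMg conjgM conjgKV.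
  have := len_mul_simple_r We Ss; case: ifP => [ein|ein _].
    by rewrite Es => E; have := leq_pred (len e); rewrite -E ltnn.
  by rewrite addbF => /(inversions_gen sJS Jv); rewrite groupJr ?groupV.
have Jr1 : s ^ e^-1 \in J.
  apply: (len_eq1 sJS Jr).
  have := lenM_min sJS We lmin Jr; rewrite conjgE invgK !mulgA mulgKV Es.
  by rewrite -add1n => /addIn.
have IH' := IH (w * s) (leq_trans lt ltn).
have KJs : s \in <<K :&: J :^ e>> by rewrite mem_gen // inE Ks mem_conjg.
rewrite -(groupMr w KJs) IH' ?(groupM Kw (mem_gen Ks)) //.
by rewrite mem_conjg conjMg groupM.
Qed.

(** An element of least length in the whole double coset is least on both sides. *)
Lemma double_coset_min J K w : J \subset S -> K \subset S -> w \in W ->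
  exists x e y, [/\ [/\ x \in <<J>>, e \in W & y \in <<K>>], w = x * e * y,
                 left_min J e & right_min K e].
Proof.
move=> sJS sKS Ww; pose P p := (p.1 \in <<J>>) && (p.2 \in <<K>>).
have P1 : P (1, 1) by rewrite /P !group1.
have [[x y] /andP[/= Jx Ky] pmin] := arg_minnP (fun p => len (p.1 * w * p.2)) P1.
have We : x * w * y \in W by rewrite !groupM ?(gen_subW _ Jx) ?(gen_subW _ Ky).
exists x^-1, (x * w * y), y^-1; split.
- by rewrite !groupV.
- by rewrite !mulgA mulVg mul1g mulgK.
- apply/forall_inP=> u Ju; rewrite !mulgA.
  by apply: (pmin (u * x, y)); rewrite /P /= groupM.
apply/forall_inP=> u Ku; have Wu := gen_subW sKS Ku.
have := pmin (x, y * u^-1); rewrite /P /= Jx groupM ?groupV // mulgA => /(_ isT).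
by rewrite -[len (_ * u^-1)]lenV ?(groupM We (groupVr Wu)) // invMg invgK (lenV We).
Qed.

(** For intersections, decompose a b^-1 = x e y; up to conjugation by y b the two parabolics are
    <<J>>^e and <<K>>, whose intersection is given by [kilmoyer]. *)
Lemma parabolics_collection : collection W (parabolics W S).
Proof.
have par J a : J \subset S -> a \in W -> (<<J>> :^ a)%G \in parabolics W S.
  by move=> sJS Wa; apply/imset2P; exists J a; rewrite ?inE.
split.
- move=> H /imset2P[J a]; rewrite inE => sJS Wa ->.
  by rewrite /= -(conjGid Wa) conjSg gen_sub_W.
- have := par S 1 (subxx S) (group1 W); rewrite (_ : (<<S>> :^ 1)%G = W) //.
  by apply: val_inj; rewrite /= conjsg1.
- move=> H1 H2 /imset2P[J a]; rewrite inE => sJS Wa -> /imset2P[K b].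
  rewrite inE => sKS Wb ->.
  have [|x [e [y [[Jx We Ky] E lmin rmin]]]] := @double_coset_min J K (a * b^-1) sJS sKS.
    by rewrite groupM ?groupV.
  pose L := K :&: J :^ e.
  suff -> : (<<J>> :^ a :&: <<K>> :^ b)%G = (<<L>> :^ (y * b))%G.
    by rewrite par ?groupM ?(gen_subW _ Ky) // (subset_trans (subsetIl _ _)).
  apply: val_inj => /=.
  have -> : a = x * e * (y * b) by rewrite mulgA -E mulgKV.
  rewrite [in RHS]conjsgM !conjsgM (conjGid Jx) -!conjIg; congr (_ :^ _).
  rewrite -{1}(conjGid Ky) -conjIg setIC; congr (_ :^ _).
  apply/eqP; rewrite eqEsubset kilmoyer // subsetI genS ?subsetIl //=.
  by rewrite -genJ genS ?subsetIr.
move=> H g /imset2P[J a]; rewrite inE => sJS Wa -> Wg.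
suff -> : ((<<J>> :^ a) :^ g)%G = (<<J>> :^ (a * g))%G by rewrite par ?groupM.
by apply: val_inj; rewrite /= conjsgM.
Qed.

(** * Longest elements *)

Lemma inversions_conj u x : u \in W -> x \in inversions u ->
  exists s v, [/\ s \in S, v \in W & x = s ^ v].
Proof.
rewrite -{1}gen_SW => /wprod_ex[ws sS ->]; elim: ws sS x => [|s ws IH] sS x /=.
  by rewrite inversions1 inE.
have Ss : s \in S by rewrite sS ?mem_head.
have sws : {subset ws <= S} by move=> y yw; rewrite sS // inE yw orbT.
have wW : wprod ws \in W by rewrite -gen_SW wprod_mem.
rewrite inversionsM ?(simple_mem Ss) // (inversions_simple Ss) in_set1.
have [->|_] /= := eqVneq x s; first by exists s, 1; rewrite conjg1 group1.
case/(IH sws)=> r [v [Sr Wv e]]; exists r, (v * s^-1); split=> //.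
  by rewrite groupM ?groupV ?(simple_mem Ss).
by rewrite conjgM -e conjgK.
Qed.

(** For a reflection x = v^-1 s v the cocycle contributions of v^-1 and v cancel, leaving that of
    s. *)
Lemma inversions_self u x : u \in W -> x \in inversions u -> x \in inversions x.
Proof.
move=> Wu /(inversions_conj Wu)[s [v [Ss Wv ->]]].
rewrite {2}conjgE !inversionsM ?groupM ?groupV ?(simple_mem Ss) // conjgK.
rewrite (inversions_simple Ss) in_set1 inversionsV // conjgK.
have -> : s ^ s = s by rewrite conjgE mulKg.
by rewrite eqxx; case: (_ \in _).
Qed.

(** Take w of maximal length in <<J>>. For an inversion x of an element of <<J>>, exactly one of w
    and x w has x as an inversion; it must be w, or else w = x (x w) would be shorter than x w. So
    N(w) contains every N(u^-1), and the cocycle rule subtracts lengths. *)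
Lemma longest_ex J : J \subset S -> exists2 w, w \in <<J>> &
  {in <<J>>, forall u, len (u * w) + len u = len w}.
Proof.
move=> sJS; have [w Jw wmax] := arg_maxnP len (group1 <<J>>).
have Ww := gen_subW sJS Jw; exists w => // u Ju.
have Wu := gen_subW sJS Ju.
have inv_w x : x \in inversions u^-1 -> x \in inversions w.
  move: {u Ju Wu}u^-1 (groupVr Ju) (groupVr Wu) => u Ju Wu.
  move=> xu; have Jx := inversions_gen sJS Ju xu; have Wx := gen_subW sJS Jx.
  have xx := inversions_self Wu xu.
  have x2 : x * x = 1.
    have [s [v [Ss _ ->]]] := inversions_conj Wu xu.
    by rewrite -conjMg (simple_sq Ss) conj1g.
  rewrite -[w]mul1g -x2 -mulgA.
  rewrite inversionsM ?groupM // xx conjgE mulKg.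
  apply/negP=> /(inversions_lt (groupM Wx Ww)); rewrite mulgA x2 mul1g ltnNge.
  by move/negP; apply; apply: wmax (groupM Jx Jw).
rewrite -(lenV Wu) addnC /len -(cardJg (inversions (u * w)) u).
rewrite -(cardsID (inversions u^-1) (inversions w)).
rewrite (setIidPr _); last by apply/subsetP.
congr addn; apply: eq_card => x; rewrite mem_conjg in_setD inversionsM // conjgKV.
rewrite -inversionsV //; case: (boolP (x \in _)) => [xu|//].
by rewrite (inv_w _ xu).
Qed.

Lemma len_mul u v : u \in W -> v \in W -> len (u * v) <= len u + len v.
Proof.
rewrite -gen_SW => /(reduced_word (subxx S))[us [sus -> <-]].
move=> /(reduced_word (subxx S))[vs [svs -> <-]].
rewrite -wprod_cat -size_cat len_word // => x.
by rewrite mem_cat => /orP[/sus|/svs].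
Qed.

Section Longest.

Variables (J : {set gT}) (w0 : gT).
Hypotheses (sJS : J \subset S) (Jw0 : w0 \in <<J>>).
Hypothesis lenw0 : {in <<J>>, forall u, len (u * w0) + len u = len w0}.

(** Write v = u w0. Right multiplication by w0 reverses lengths on <<J>>, so a left descent of u in
    J would be a left ascent of v. *)
Lemma longest_unique v : v \in <<J>> ->
  {in J, forall s, len (s * v) < len v} -> v = w0.
Proof.
move=> Jv desc; have Ju : v * w0^-1 \in <<J>> by rewrite groupM ?groupV.
have [/eqP|u1] := eqVneq (v * w0^-1) 1; first by rewrite -eq_mulgV1 => /eqP.
have [s Js lt] := descent_left sJS Ju u1.
have := desc s Js; have := lenw0 Ju; rewrite mulgKV => e1.
have := lenw0 (groupM (mem_gen Js) Ju); rewrite -!mulgA mulVg mulg1 => e2.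
rewrite ltnNge => /negP[].
by rewrite -(leq_add2r (len (s * (v * w0^-1)))) e2 -e1 leq_add2l ltnW.
Qed.

Lemma longest_sq : w0 * w0 = 1.
Proof.
apply: len_eq0; first by rewrite groupM ?(gen_subW sJS).
by apply/eqP; rewrite -(eqn_add2r (len w0)) lenw0.
Qed.
Lemma longestV : w0^-1 = w0.
Proof. by apply/eqP; rewrite eq_invg_mul longest_sq. Qed.

Lemma len_longestM u : u \in <<J>> -> len (w0 * u) + len u = len w0.
Proof.
move=> Ju; have Wu := gen_subW sJS Ju; have Ww0 := gen_subW sJS Jw0.
rewrite -(lenV Wu) -[len (w0 * u)]lenV ?groupM // invMg longestV.
by rewrite lenw0 ?groupV.
Qed.

Lemma longestJ s : s \in J -> s ^ w0 \in J.
Proof.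
move=> Js; have Ss := subsetP sJS _ Js; have Jgs := mem_gen Js.
apply: (len_eq1 sJS); first by rewrite groupJ.
apply/eqP; rewrite conjgE longestV -(eqn_add2r (len (s * w0))).
by rewrite len_longestM ?groupM // -(lenw0 Jgs) (len_simple Ss) addnC.
Qed.

Lemma longest_mem s : s \in S -> (len (s * w0) < len w0) = (s \in J).
Proof.
move=> Ss; have Ww0 := gen_subW sJS Jw0; apply/idP/idP => [|Js].
  rewrite len_mul_simple_l //; case: ifP => [sw _|_]; last by rewrite ltnNge leqW.
  exact: simple_gen (inversions_gen sJS Jw0 sw).
by rewrite -(lenw0 (mem_gen Js)) (len_simple Ss) addn1.
Qed.

End Longest.

Definition left_ascents d := [set s in S | len d < len (s * d)].

(* The element is [w0 * w_K]. *)
Lemma right_min_ascents_unique K : K \subset S -> exists2 d,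
  [/\ d \in W, right_min K d & left_ascents d = K :^ d^-1] &
  forall d', d' \in W -> right_min K d' -> left_ascents d' = K :^ d'^-1 -> d' = d.
Proof.
move=> sKS; have [wK KwK lenK] := longest_ex sKS.
have [w0 Sw0 len0] := longest_ex (subxx S).
have sSS := subxx S; have Ww0 := gen_subW sSS Sw0; have WwK := gen_subW sKS KwK.
have Sgen u : u \in W -> u \in <<S>> by rewrite gen_SW.
exists (w0 * wK).

  have lenE u : u \in W -> len (w0 * u) = len w0 - len u.
    by move=> Wu; rewrite -(len_longestM sSS Sw0 len0 (Sgen u Wu)) addnK.
  split; first by rewrite groupM.
    apply/forall_inP=> k Kk; have Wk := gen_subW sKS Kk.
    have Wd := groupM Ww0 WwK.
    rewrite (lenV Wd) -[len (k * _)]lenV ?(groupM Wk (groupVr Wd)) // invMg invgK.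
    rewrite -mulgA !lenE ?groupM ?groupV // leq_sub2l //.
    by rewrite -(len_longestM sKS KwK lenK (groupVr Kk)) leq_addr.
  apply/setP=> s; rewrite inE mem_conjgV.
  have -> : s ^ (w0 * wK) = (s ^ w0) ^ wK by rewrite conjgM.
  have KJ t : (t ^ wK \in K) = (t \in K).
    apply/idP/idP => [/(longestJ sKS KwK lenK)|]; last exact: longestJ.
    by rewrite -conjgM (longest_sq sKS KwK lenK) conjg1.
  rewrite KJ; case: (boolP (s \in S)) => /= [Ss|nSs]; last first.
    apply/esym/negP=> /(subsetP sKS)/(longestJ sSS Sw0 len0).
    by rewrite -conjgM (longest_sq sSS Sw0 len0) conjg1 (negPf nSs).
  have St := longestJ sSS Sw0 len0 Ss.
  rewrite -(longest_mem sKS KwK lenK St).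
  have -> : s * (w0 * wK) = w0 * (s ^ w0 * wK).
    by rewrite conjgE (longestV sSS Sw0 len0) !mulgA (longest_sq sSS Sw0 len0) mul1g.
  have Wt := simple_mem St.
  have lew u : u \in W -> len u <= len w0.
    by move=> Wu; rewrite -(len_longestM sSS Sw0 len0 (Sgen u Wu)) leq_addl.
  rewrite (lenE _ WwK) (lenE _ (groupM Wt WwK)); have := lew _ WwK; have := lew _ (groupM Wt WwK).
  by move=> le1 le2; rewrite ltn_sub2lE.
(* Uniqueness: every s in S is a left descent of d wK, which is therefore w0. If s is an ascent of
   d, then s d = d k with k in K, and k shortens wK; otherwise s already shortens d. *)
move=> d Wd dmin asc; rewrite -(mulgK wK d) (longestV sKS KwK lenK); congr (_ * _).
apply: (longest_unique sSS Sw0 len0); first by rewrite Sgen ?groupM.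
move=> s Ss; rewrite (lenM_rmin sKS Wd dmin KwK).
have [sa|sna] := boolP (s \in left_ascents d).
  have Kk : s ^ d \in K by rewrite -mem_conjgV -asc.
  have -> : s * (d * wK) = d * (s ^ d * wK) by rewrite conjgE !mulgA mulgV mul1g.
  rewrite (lenM_rmin sKS Wd dmin (groupM (mem_gen Kk) KwK)) ltn_add2l.
  by rewrite (longest_mem sKS KwK lenK) // (subsetP sKS).
have lt : len (s * d) < len d.
  move: sna; rewrite inE Ss /= len_mul_simple_l //; case: ifP => [sd _|_].
    by have := inversions_lt Wd sd; rewrite len_mul_simple_l // sd.
  by rewrite ltnSn.
rewrite mulgA; apply: leq_ltn_trans (len_mul _ _) _; rewrite ?groupM ?(simple_mem Ss) //.
by rewrite ltn_add2r.
Qed.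

(** * Marks of the sign unit *)

Lemma left_min_unique J d u : J \subset S -> d \in W -> u \in <<J>> ->
  left_min J d -> left_min J (u * d) -> u = 1.
Proof.
move=> sJS Wd Ju dmin udmin; have Wu := gen_subW sJS Ju.
have /eqP := lenM_min sJS (groupM Wu Wd) udmin (groupVr Ju).
rewrite mulKg (lenM_min sJS Wd dmin Ju) addnA -{1}[len d]add0n eqn_add2r.
by rewrite eq_sym addn_eq0 => /andP[_ /eqP]; apply: len_eq0.
Qed.

Lemma left_min_ascents J d : d \in W ->
  (J \subset S) && left_min J d = (J \subset left_ascents d).
Proof.
move=> Wd; apply/andP/subsetP=> [[sJS /(left_minP sJS Wd) asc] s Js|asc].
  by rewrite inE asc // (subsetP sJS).
have sJS : J \subset S by apply/subsetP=> s /asc; rewrite inE => /andP[].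
by split=> //; apply/left_minP=> // s /asc; rewrite inE => /andP[].
Qed.

(** Each fixed coset is counted by its unique minimal representative. *)
Lemma card_fix_parabolic (H : {group gT}) J : J \subset S ->
  #|'Fix_(rcosets <<J>> W | 'Rs)(H)| =
    #|[set d in W | left_min J d && (H \subset <<J>> :^ d)]|.
Proof.
move=> sJS; rewrite -(@card_in_imset _ _ (fun d => <<J>> :* d)); last first.
  move=> d d'; rewrite !inE => /and3P[Wd dmin _] /and3P[Wd' dmin' _] /esym eqd.
  have /rcosetP[u Ju e] : d' \in <<J>> :* d by rewrite -eqd rcoset_refl.
  by rewrite e (left_min_unique sJS Wd Ju dmin) ?mul1g // -e.
apply: eq_card => C; apply/setIP/imsetP=> [[/rcosetsP[w Ww ->]]|[d]].
  rewrite sub_afixRs_norms => fixw; have [u Ju umin] := coset_min J w.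
  exists (u * w); last by rewrite rcosetM (rcoset_id Ju).
  by rewrite inE (groupM (gen_subW sJS Ju) Ww) umin conjsgM (conjGid Ju).
rewrite [d \in _]inE => /and3P[Wd _ fixd] ->; rewrite sub_afixRs_norms; split=> //.
by apply/rcosetsP; exists d.
Qed.

(** Write d = x e y with e minimal on both sides. By [kilmoyer], H lies in a conjugate of <<K :&:
    J^e>>, so minimality of K forces K into J^e. Then y can be moved across e into <<J>>, so d lies
    in <<J>> e, and both being minimal gives d = e. *)
Lemma sub_parabolic_conj (H : {group gT}) K J d :
    K \subset S -> H \subset <<K>> ->
    (forall (L : {set gT}) a, L \subset S -> a \in W -> H \subset <<L>> :^ a -> #|K| <= #|L|) ->
    J \subset S -> d \in W -> left_min J d ->
  (H \subset <<J>> :^ d) = right_min K d && (K \subset J :^ d).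
Proof.
move=> sKS sHK minK sJS Wd dmin; apply/idP/andP=> [sHJ | [_ sKJ]]; last first.
  by apply: subset_trans sHK _; rewrite -genJ genS.
have [x [e [y [[Jx We Ky] ed emin]]]] := double_coset_min sJS sKS Wd.
have Wy := gen_subW sKS Ky => ermin.
have sKJ : K \subset J :^ e.
  have : #|K| <= #|K :&: J :^ e|.
    apply: (minK _ y); rewrite ?(subset_trans (subsetIl _ _)) //.
    have := kilmoyer sJS sKS We emin ermin; rewrite -(conjSg _ _ y).
    apply: subset_trans; rewrite conjIg (conjGid Ky) subsetI sHK.
    by move: sHJ; rewrite ed !conjsgM (conjGid Jx).
  by move=> le; apply/setIidPl/eqP; rewrite eqEcard subsetIl.
have Jv : x * y ^ e^-1 \in <<J>>.
  rewrite groupM // -mem_conjg -genJ.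
  by apply: subsetP Ky; rewrite genS.
have dE : d = x * y ^ e^-1 * e by rewrite ed conjgE invgK !mulgA mulgKV.
have v1 := left_min_unique sJS We Jv emin; rewrite -dE in v1.
by rewrite dE (v1 dmin) mul1g.
Qed.

Lemma mark_sign_unit_min (H : {group gT}) K :
    K \subset S -> H \subset <<K>> ->
    (forall (L : {set gT}) a, L \subset S -> a \in W -> H \subset <<L>> :^ a -> #|K| <= #|L|) ->
  mark H (sign_unit W S) = ((-1) ^+ #|K|)%R.
Proof.
move=> sKS sHK minK.
have sHW : H \subset W := subset_trans sHK (gen_sub_W sKS).
(* After exchanging the sums, the subsets J for which d is counted form the interval from d K d^-1
   to the left ascents of d. *)
pose F d : int := (\sum_(J : {set gT} | (K :^ d^-1 \subset J) && (J \subset left_ascents d)) (-1) ^+ #|J|)%R.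
transitivity (\sum_(d in W | right_min K d) F d)%R.
  rewrite raddf_sum /=.
  transitivity (\sum_(J in powerset S) \sum_(d in [set d in W | left_min J d && (H \subset <<J>> :^ d)])
     (-1) ^+ #|J| : int)%R.
    apply: eq_bigr => J; rewrite inE => sJS.
    rewrite sumr_const -signr_odd mulr_sign -[in RHS]signr_odd.
    have E : mark H (Gclass W <<J>>) = (#|[set d in W | left_min J d && (H \subset <<J>> :^ d)]|%:Z)%R.
      by rewrite mark_Gclass ?gen_sub_W // card_fix_parabolic.
    by case: (odd _); rewrite ?raddfN /= E ?expr0 ?expr1 ?mulNrn ?natz.
  rewrite (exchange_big_dep (fun d => (d \in W) && right_min K d)) /=.
    apply: eq_bigr => d /andP[Wd dmin]; apply: eq_bigl => J.
    rewrite -left_min_ascents // !inE Wd /= sub_conjgV.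
    case: (boolP (J \subset S)) => [sJS|]; rewrite ?andbF //=.
    case: (boolP (left_min J d)) => [Jmin|]; rewrite ?andbF //=.
    by rewrite (sub_parabolic_conj sKS sHK minK) // dmin andbT.
  move=> J d; rewrite !inE => sJS /and3P[Wd Jmin].
  by rewrite (sub_parabolic_conj sKS sHK minK) // Wd => /andP[].
have [d [Wd dmin asc] uniq_d] := right_min_ascents_unique sKS.
rewrite (bigD1 d) ?Wd //= big1 ?addr0 => [|d' /andP[/andP[Wd' dmin'] nd]].
  by rewrite /F sign_sum_interval asc eqxx cardJg mulr1n.
rewrite /F sign_sum_interval; case: eqP => [E|//].
by rewrite (uniq_d d') ?eqxx // in nd.
Qed.

End Inversions.

(** Counting elements rather than cosets turns fixed points into a condition on w that can be
    translated by conjugation and split along a product. *)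
Lemma card_fix_rcosets (gT : finGroupType) (G K H : {group gT}) : K \subset G ->
  #|[set w in G | H \subset K :^ w]| = (#|'Fix_(rcosets K G | 'Rs)(H)| * #|K|)%N.
Proof.
move=> sKG; apply: card_uniform_partition.
  by move=> C /setIP[/rcosetsP[w _ ->] _]; rewrite card_rcoset.
have /and3P[_ triv n0] := rcosets_partition sKG.
apply/and3P; split; last by apply: contra n0 => /setIP[].
  apply/eqP/setP=> w; apply/bigcupP/setIdP=> [[C /setIP[/rcosetsP[v Gv ->]]]|[Gw sHK]].
    rewrite sub_afixRs_norms => sHK /rcosetP[k Kk ->].
    by rewrite conjsgM (conjGid Kk) groupM // (subsetP sKG).
  exists (K :* w); last exact: rcoset_refl.
  by rewrite inE sub_afixRs_norms sHK -rcosetE imset_f.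
by apply: trivIsetS triv; apply: subsetIl.
Qed.

Lemma card_fix_conj (gT : finGroupType) (G K H : {group gT}) a :
  K \subset G -> a \in G ->
  #|'Fix_(rcosets K G | 'Rs)(H :^ a)| = #|'Fix_(rcosets K G | 'Rs)(H)|.
Proof.
move=> sKG Ga; apply/eqP; rewrite -(eqn_pmul2r (cardG_gt0 K)).
rewrite -(card_fix_rcosets (H :^ a) sKG) -card_fix_rcosets //; apply/eqP.
rewrite -(card_rcoset [set w in G | H \subset K :^ w] a).
apply: eq_card => w; rewrite mem_rcoset !inE groupMr ?groupV //.
by rewrite conjsgM -sub_conjg.
Qed.

Lemma mark_conj (gT : finGroupType) (G H : {group gT}) a x : a \in G ->
  mark (G := G) (H :^ a) x = mark H x.
Proof.
move=> Ga; rewrite /mark; apply: eq_bigr => C _.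
by rewrite card_fix_conj ?subgroup_class_sub.
Qed.

(** * The sign unit of a Coxeter system *)

Section CoxeterSystems.

Variables (gT : finGroupType) (W : {group gT}) (S : {set gT}).
Hypothesis WS : coxeter_system W S.

Lemma coxeter_sqr s : s \in S -> s ^+ 2 = 1.
Proof. by move=> /(coxeter_invol WS) <-; apply: expg_order. Qed.

Lemma coxeter_neq1 s : s \in S -> s != 1.
Proof. by move=> /(coxeter_invol WS) s2; rewrite -order_gt1 s2. Qed.

Lemma coxeter_refl_perm : exists2 h : gT -> {perm gT * bool},
  {in W &, {morph h : x y / x * y}} & {in S, h =1 @refl_perm gT}.
Proof.
apply: (coxeter_presentation WS) => s t Ss St.
by apply: refl_perm_rel; apply: coxeter_sqr.
Qed.

Lemma coxeter_collection : collection W (parabolics W S).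
Proof.
have [h hM hS] := coxeter_refl_perm.
exact: parabolics_collection (coxeter_gen WS) (coxeter_invol WS) hM hS.
Qed.

Lemma coxeter_sub (J : {set gT}) : J \subset S -> <<J>> \subset W.
Proof. by move=> sJS; rewrite -(coxeter_gen WS) genS. Qed.

Lemma coxeter_mem s : s \in S -> s \in W.
Proof. by move=> Ss; rewrite -(coxeter_gen WS) mem_gen. Qed.

Lemma mark_sign_unit (H : {group gT}) (K : {set gT}) a :
    K \subset S -> a \in W -> H \subset <<K>> :^ a ->
    (forall (L : {set gT}) b, L \subset S -> b \in W -> H \subset <<L>> :^ b -> #|K| <= #|L|) ->
  mark H (sign_unit W S) = ((-1) ^+ #|K|)%R.
Proof.
move=> sKS Wa sHK minK; have [h hM hS] := coxeter_refl_perm.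
rewrite -(mark_conj _ _ (groupVr Wa)).
apply: (mark_sign_unit_min (coxeter_gen WS) (coxeter_invol WS) hM hS sKS).
  by rewrite sub_conjgV.
move=> L b sLS Wb; rewrite sub_conjgV -conjsgM; apply: minK => //.
by rewrite groupM.
Qed.

Lemma mark_sign_unit_sqr (H : {group gT}) : H \subset W ->
  (mark H (sign_unit W S) * mark H (sign_unit W S) = 1)%R.
Proof.
move=> sHW.
(* Pairs describing the parabolics that contain H; one with fewest generators is chosen. *)
pose P (p : {set gT} * gT) := [&& p.1 \subset S, p.2 \in W & H \subset <<p.1>> :^ p.2].
have P1 : P (S, 1) by rewrite /P /= subxx group1 conjsg1 (coxeter_gen WS).
have [[K a] /and3P[/= sKS Wa sHK] minK] := arg_minnP (fun p : {set gT} * gT => #|p.1|) P1.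
rewrite (mark_sign_unit sKS Wa sHK) -?expr2 ?sqrr_sign // => L b sLS Wb sHL.
by apply: (minK (L, b)); rewrite /P /= sLS Wb.
Qed.

Lemma mark1_sign_unit : mark 1%G (sign_unit W S) = 1%R.
Proof.
by rewrite (@mark_sign_unit _ set0 1) ?cards0 ?sub0set ?group1 ?sub1G.
Qed.

Lemma mark_cycle_sign_unit s : s \in S -> mark <[s]>%G (sign_unit W S) = (-1)%R.
Proof.
move=> Ss; rewrite (@mark_sign_unit _ [set s] 1) ?cards1 ?sub1set ?group1 ?conjsg1 //.
move=> L b sLS Wb; rewrite card_gt0 cycle_subG; apply: contraTneq => ->.
by rewrite /= gen0 conjs1g inE coxeter_neq1.
Qed.

Lemma sign_unit_partial : partial_burnside (parabolics W S) (sign_unit W S).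
Proof.
apply: partial_burnside_sum => J; rewrite inE => sJS.
rewrite -signr_odd mulr_sign.
have pJ : partial_burnside (parabolics W S) (Gclass W <<J>>).
  apply: partial_burnside_class; apply/imset2P; exists J 1; rewrite ?inE ?group1 //.
  by apply: val_inj; rewrite /= conjsg1.
by case: odd => //; apply: partial_burnsideN.
Qed.

Lemma sign_unit_sqr : (sign_unit W S * sign_unit W S = 1)%R.
Proof.
by apply: mark_inj => H sHW; rewrite [LHS]markM // mark_sign_unit_sqr // mark1.
Qed.

End CoxeterSystems.

Lemma gen_left_ind (gT : finGroupType) (J : {set gT}) (P : gT -> Prop) :
  P 1 -> (forall s w, s \in J -> w \in <<J>> -> P w -> P (s * w)) ->
  forall w, w \in <<J>> -> P w.
Proof.
move=> P1 PM w /wprod_ex[ws sJ ->]; elim: ws sJ => [|s ws IH] //= sJ.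
have sws : {subset ws <= J} by move=> x xw; rewrite sJ // inE xw orbT.
by apply: PM; rewrite ?sJ ?mem_head ?wprod_mem //; apply: IH.
Qed.

(** Since [W/H] depends only on the conjugacy class of H, a linear statement on the span need only
    be checked on standard parabolics. *)
Lemma partial_parabolics_ind (gT : finGroupType) (W : {group gT}) (S : {set gT})
    (P : burnside W -> Prop) :
  (forall x y, P x -> P y -> P (x + y)%R) -> (forall x n, P x -> P (x *~ n)%R) ->
  (forall J : {set gT}, J \subset S -> P (Gclass W <<J>>)) ->
  forall x, partial_burnside (parabolics W S) x -> P x.
Proof.
move=> PD PMz PG x [c ->]; elim/big_ind: _ => //.
  by rewrite -(mulr0z (Gclass W <<set0>>)); apply/PMz/PG/sub0set.
move=> H /imset2P[J w]; rewrite inE => sJS Ww ->; apply: PMz.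
by rewrite GclassJ //; apply: PG.
Qed.

(** * Irreducible components *)

Section Components.

Variables (gT : finGroupType) (W : {group gT}) (S : {set gT}).
Variables (l : nat) (Sc : 'I_l -> {set gT}).
Hypothesis WS : coxeter_system W S.
Hypothesis Sc_inj : injective Sc.
Hypothesis Sc_components : [set Sc t | t : 'I_l] = coxeter_components S.

Lemma coxeter_graph_sym : symmetric (coxeter_graph S).
Proof.
move=> s t; rewrite /coxeter_graph /= andbCA; congr [&& _, _ & _].
by rewrite -(orderJ (s * t) s) conjgE -!mulgA mulKg.
Qed.

Lemma components_equiv : {in S & &, equivalence_rel (connect (coxeter_graph S))}.
Proof.
move=> x y z _ _ _; split=> [|cxy]; first exact: connect0.
by apply: same_connect => //; apply/sym_connect_sym/coxeter_graph_sym.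
Qed.

Lemma components_partition : partition [set Sc t | t : 'I_l] S.
Proof. by rewrite Sc_components; apply: equivalence_partitionP components_equiv. Qed.

Lemma component_sub t : Sc t \subset S.
Proof.
have /and3P[/eqP <- _ _] := components_partition.
by apply: (bigcup_max (Sc t)) => //; apply: imset_f.
Qed.

Lemma component_ex s : s \in S -> exists t, s \in Sc t.
Proof.
have /and3P[/eqP <- _ _] := components_partition.
by case/bigcupP=> A /imsetP[t _ ->] st; exists t.
Qed.

Lemma component_uniq s t j : s \in Sc t -> s \in Sc j -> t = j.
Proof.
have /and3P[_ triv _] := components_partition => st sj; apply: Sc_inj.
by rewrite -(def_pblock triv _ st) ?imset_f // (def_pblock triv _ sj) ?imset_f.
Qed.

Lemma component_neq0 t : exists s, s \in Sc t.
Proof.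
have /and3P[_ _ n0] := components_partition; apply/set0Pn.
by apply: contraNneq n0 => <-; apply: imset_f.
Qed.

(** An order above 2 would be an edge joining the two components, and order 1 would give r = s. *)
Lemma component_order s r t j : s \in Sc t -> r \in Sc j -> t != j -> #[s * r] = 2.
Proof.
move=> st rj ntj; have [Ss Sr] := (subsetP (component_sub t) _ st, subsetP (component_sub j) _ rj).
have sr1 : s * r != 1.
  rewrite -eq_invg_mul; apply: contraNneq ntj => e.
  apply/eqP/(component_uniq st); suff <- : r = s by [].
  by rewrite -e; apply/eqP; rewrite eq_invg_mul -expg2 (coxeter_sqr WS).
apply/eqP; rewrite eqn_leq order_gt1 sr1 andbT leqNgt; apply: contraNN ntj => gt2.
have edge : connect (coxeter_graph S) s r by apply: connect1; rewrite /coxeter_graph /= Ss Sr.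
have /and3P[_ triv _] := components_partition.
have rs : r \in pblock [set Sc t | t : 'I_l] s.
  by rewrite Sc_components pblock_equivalence_partition //; apply: components_equiv.
have /esym := same_pblock triv rs.
by rewrite (def_pblock triv _ rj) ?(def_pblock triv _ st) ?imset_f // => /Sc_inj/eqP.
Qed.

Lemma component_commute s r t j : s \in Sc t -> r \in Sc j -> t != j -> commute s r.
Proof.
move=> st rj ntj; have Ss := subsetP (component_sub t) _ st.
have Sr := subsetP (component_sub j) _ rj.
have inv u : u \in S -> u^-1 = u.
  by move=> Su; apply/eqP; rewrite eq_invg_mul -expg2 (coxeter_sqr WS).
have e : (s * r)^-1 = s * r.
  by apply/eqP; rewrite eq_invg_mul -expg2 -(component_order st rj ntj) expg_order.
by rewrite /commute -{1}e invMg !inv.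
Qed.

(** The universal property applies to the map fixing S_t and killing the other generators: a mixed
    relation has exponent 2, and the surviving generator is an involution. *)
Lemma component_projections : exists p : 'I_l -> gT -> gT, forall t,
  [/\ {in W &, {morph p t : x y / x * y}}, {in Sc t, p t =1 id} &
      forall j, j != t -> {in Sc j, p t =1 fun=> 1}].
Proof.
suff ex t : exists p : gT -> gT, [/\ {in W &, {morph p : x y / x * y}}, {in Sc t, p =1 id} &
      forall j, j != t -> {in Sc j, p =1 fun=> 1}].
  by have [p] := fin_all_exists ex; exists p.
pose f s := if s \in Sc t then s else 1.
have [s r Ss Sr|p pM pf] := @coxeter_presentation _ _ _ WS gT f.
  rewrite /f; case: ifPn => st; case: ifPn => rt; first exact: expg_order.
  - have [j rj] := component_ex Sr.
    have ntj : t != j by apply: contraNneq rt => ->.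
    by rewrite (component_order st rj ntj) mulg1 (coxeter_sqr WS).
  - have [j sj] := component_ex Ss.
    have ntj : j != t by apply: contraNneq st => <-.
    by rewrite (component_order sj rt ntj) mul1g (coxeter_sqr WS).
  by rewrite mulg1 expg1n.
exists p; split=> // [s st|j ntj s sj].
  by rewrite pf ?(subsetP (component_sub t)) // /f st.
rewrite pf ?(subsetP (component_sub j)) // /f ifN //.
by apply: contraNN ntj => st; apply/eqP/(component_uniq sj st).
Qed.

(** A map on S_t satisfying the relations is extended by 1 to S, and the homomorphism from W is
    restricted. *)
Lemma component_coxeter t : coxeter_system <<Sc t>> (Sc t).
Proof.
split=> // [s st|H f fr].
  by apply: (coxeter_invol WS); apply: subsetP st; apply: component_sub.
pose g s := if s \in Sc t then f s else 1.
have [s r Ss Sr|h hM hf] := @coxeter_presentation _ _ _ WS H g.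
  rewrite /g; case: ifPn => st; case: ifPn => rt; first exact: fr.
  - have [j rj] := component_ex Sr.
    have ntj : t != j by apply: contraNneq rt => ->.
    rewrite (component_order st rj ntj) mulg1; have := fr s s st st.
    by rewrite -(expg2 s) (coxeter_sqr WS) // order1 expg1.
  - have [j sj] := component_ex Ss.
    have ntj : j != t by apply: contraNneq st => <-.
    rewrite (component_order sj rt ntj) mul1g; have := fr r r rt rt.
    by rewrite -(expg2 r) (coxeter_sqr WS) // order1 expg1.
  by rewrite mulg1 expg1n.
have sub := subsetP (coxeter_sub WS (component_sub t)).
exists h => [x y xt yt|s st]; first by rewrite hM ?sub.
by rewrite hf ?(subsetP (component_sub t)) // /g st.
Qed.

End Components.

Lemma component_embeddingB (gT : finGroupType) (W : {group gT}) (l : nat)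
    (Wc : 'I_l -> {group gT}) (t : 'I_l) :
  {morph component_embedding W Wc t : x y / (x - y)%R}.
Proof.
move=> x y; rewrite /component_embedding -sumrB; apply: eq_bigr => C _.
by rewrite !ffunE mulrzBr.
Qed.

HB.instance Definition _ gT W l Wc t := GRing.isZmodMorphism.Build
  (burnside (Wc t)) (burnside W) (component_embedding W Wc t)
  (@component_embeddingB gT W l Wc t).

(** * Product subgroups *)

Section Projections.

Variables (gT : finGroupType) (W : {group gT}) (S : {set gT}).
Variables (l : nat) (Sc : 'I_l -> {set gT}).
Hypothesis WS : coxeter_system W S.
Hypothesis Sc_inj : injective Sc.
Hypothesis Sc_components : [set Sc t | t : 'I_l] = coxeter_components S.
Variable p : 'I_l -> gT -> gT.
Hypothesis pM : forall t, {in W &, {morph p t : x y / x * y}}.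
Hypothesis p_id : forall t, {in Sc t, p t =1 id}.
Hypothesis p_triv : forall t j, j != t -> {in Sc j, p t =1 fun=> 1}.

Let Wc t : {group gT} := <<Sc t>>%G.
Let Sc_sub := component_sub Sc_components.
Let Sc_ex := component_ex Sc_components.

Lemma component_subW t : Wc t \subset W.
Proof. by have := coxeter_sub WS (Sc_sub t). Qed.

Lemma proj1 t : p t 1 = 1.
Proof. by apply: (mulgI (p t 1)); rewrite -pM ?mulg1. Qed.

Lemma proj_mem t w : w \in W -> p t w \in Wc t.
Proof.
rewrite -{1}(coxeter_gen WS) => Sw; elim/gen_left_ind: Sw => [|s {}w Ss Sw IH].
  by rewrite proj1.
have Ww : w \in W by rewrite -(coxeter_gen WS).
rewrite pM ?(coxeter_mem WS Ss) // groupM //; have [j sj] := Sc_ex Ss.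
have [e|njt] := eqVneq j t; last by rewrite (p_triv njt).
by rewrite e in sj; rewrite p_id ?mem_gen.
Qed.

Lemma proj_id t : {in Wc t, p t =1 id}.
Proof.
move=> w; elim/gen_left_ind=> [|s {}w st Sw IH]; first exact: proj1.
have sub := subsetP (component_subW t).
by rewrite (pM _ (sub _ (mem_gen st)) (sub _ Sw)) IH p_id.
Qed.

Lemma proj_triv t j : j != t -> {in Wc j, p t =1 fun=> 1}.
Proof.
move=> njt w; elim/gen_left_ind=> [|s {}w st Sw IH]; first exact: proj1.
have sub := subsetP (component_subW j).
by rewrite (pM _ (sub _ (mem_gen st)) (sub _ Sw)) IH (p_triv njt) // mulg1.
Qed.

Lemma components_cent t j : t != j -> Wc t \subset 'C(Wc j).
Proof.
move=> ntj; rewrite gen_subG /= cent_gen; apply/subsetP=> s st; apply/centP=> r rj.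
exact (component_commute WS Sc_inj Sc_components st rj ntj).
Qed.

Lemma proj_prod w : w \in W -> \prod_t p t w = w.
Proof.
rewrite -{1}(coxeter_gen WS) => Sw; elim/gen_left_ind: Sw => [|s {}w Ss Sw IH].
  by rewrite big1 // => t _; rewrite proj1.
have Ww : w \in W by rewrite -(coxeter_gen WS).
have [j sj] := Sc_ex Ss.
(* The product is noncommutative, so the factor s, which appears only at index j, is moved to the
   front past the factors of other components, with which it commutes. *)
have E r : uniq r -> \prod_(t <- r) p t (s * w) =
    (if j \in r then s else 1) * \prod_(t <- r) p t w.
  elim: r => [|i r IHr] /=; first by rewrite !big_nil mulg1.
  case/andP=> nir ur; rewrite !big_cons IHr // pM ?(coxeter_mem WS Ss) // inE.
  have [e|nji] := eqVneq j i.
    by rewrite -[i]e in nir *; rewrite p_id //= (negPf nir) mul1g mulgA.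
  rewrite (p_triv nji) // mul1g /=; case: ifP => _; rewrite ?mul1g // !mulgA.
  congr (_ * _); rewrite eq_sym in nji.
  have /centP/(_ _ (mem_gen sj)) := subsetP (components_cent nji) _ (proj_mem i Ww).
  by [].
by rewrite E ?index_enum_uniq // mem_index_enum IH.
Qed.

Lemma proj_prod_family (f : 'I_l -> gT) i : (forall t, f t \in Wc t) ->
  p i (\prod_t f t) = f i.
Proof.
move=> fW; have Wf t : f t \in W by apply: subsetP (fW t); apply: component_subW.
transitivity (\prod_(t | t == i) f t); last by rewrite big_pred1_eq.
rewrite [RHS]big_mkcond; elim: (index_enum _) => [|t r IH]; first by rewrite !big_nil proj1.
rewrite !big_cons pM ?group_prod //; rewrite IH; congr (_ * _).
by case: eqVneq => [<-|nti]; [rewrite proj_id | rewrite (proj_triv nti)].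
Qed.

Lemma card_proj (A : 'I_l -> {set gT}) : (forall t, A t \subset Wc t) ->
  #|[set w in W | [forall t, p t w \in A t]]| = (\prod_t #|A t|)%N.
Proof.
move=> sA; pose f w : {ffun 'I_l -> gT} := [ffun t => p t w].
rewrite -(@card_in_imset _ _ f); last first.
  move=> w v; rewrite !inE => /andP[Ww _] /andP[Wv _] /ffunP E.
  rewrite -(proj_prod Ww) -(proj_prod Wv); apply: eq_bigr => t _.
  by have := E t; rewrite !ffunE.
rewrite (_ : f @: _ = [set g | g \in family A]).
  by rewrite cardsE card_family foldrE big_map big_enum.
apply/setP=> g; rewrite inE; apply/imsetP/familyP=> [[w] | gA].
  by rewrite inE => /andP[Ww /forallP Aw] -> t; rewrite ffunE.
have gW t : g t \in Wc t by apply: subsetP (gA t).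
have Wg t : g t \in W by apply: subsetP (gW t); apply: component_subW.
exists (\prod_t g t); last by apply/ffunP=> t; rewrite ffunE proj_prod_family.
by rewrite inE group_prod //; apply/forallP=> t; rewrite proj_prod_family.
Qed.

Section ProductSubgroups.

Implicit Types Q R : 'I_l -> {group gT}.

(** For Q_t inside W_t this is the internal direct product of the Q_t; defining it by projections
    makes membership coordinatewise. *)
Definition prod_set Q := [set w in W | [forall t, p t w \in Q t]].

Lemma prod_group_set Q : group_set (prod_set Q).
Proof.
apply/group_setP; split=> [|x y].
  by rewrite inE group1; apply/forallP=> t; rewrite proj1.
rewrite !inE => /andP[Wx /forallP Qx] /andP[Wy /forallP Qy]; rewrite groupM //.
by apply/forallP=> t; rewrite pM ?groupM.
Qed.

Canonical prod_group Q := Group (prod_group_set Q).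

Lemma mem_prod_group Q w :
  (w \in prod_group Q) = (w \in W) && [forall t, p t w \in Q t].
Proof. by rewrite inE. Qed.

Lemma prod_group_sub Q : prod_group Q \subset W.
Proof. by apply/subsetP=> w; rewrite mem_prod_group => /andP[]. Qed.

Lemma proj_prod_group Q t : Q t \subset Wc t -> p t @: prod_group Q = Q t.
Proof.
move=> sQ; apply/setP=> x; apply/imsetP/idP=> [[w]|Qx].
  by rewrite mem_prod_group => /andP[_ /forallP Qw] ->.
have xt := subsetP sQ _ Qx; exists x; last by rewrite proj_id.
rewrite mem_prod_group (subsetP (component_subW t)) //; apply/forallP=> j.
have [->|ntj] := eqVneq j t; first by rewrite proj_id.
by rewrite (@proj_triv j t) // eq_sym.
Qed.

Lemma projV t w : w \in W -> p t w^-1 = (p t w)^-1.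
Proof. by move=> Ww; apply: (mulgI (p t w)); rewrite -pM ?groupV // !mulgV proj1. Qed.

Lemma projJ t x w : x \in W -> w \in W -> p t (x ^ w) = p t x ^ p t w.
Proof.
move=> Wx Ww; apply: (mulgI (p t w)); rewrite -pM ?groupJ // -!conjgC.
exact: pM.
Qed.

Lemma sub_prod_conj (H : {group gT}) R w : H \subset W -> w \in W ->
  (H \subset prod_group R :^ w) = [forall t, p t @: H \subset R t :^ p t w].
Proof.
move=> sHW Ww; apply/subsetP/forallP=> [sHR t|sHR x Hx].
  apply/subsetP=> _ /imsetP[x Hx ->]; have := sHR x Hx.
  rewrite !mem_conjg mem_prod_group => /andP[_ /forallP/(_ t)].
  by rewrite projJ ?groupV ?projV // (subsetP sHW).
have Wx := subsetP sHW _ Hx; rewrite mem_conjg mem_prod_group groupJ ?groupV //=.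
apply/forallP=> t; have := subsetP (sHR t) _ (imset_f (p t) Hx).
by rewrite mem_conjg projJ ?groupV ?projV.
Qed.

Lemma card_prod_group R : (forall t, R t \subset Wc t) ->
  #|prod_group R| = (\prod_t #|R t|)%N.
Proof. by move=> sR; rewrite -card_proj. Qed.

(** Counted by elements w instead of cosets, the fixed-point condition splits into one condition on
    each projection of w. *)
Lemma card_fix_prod_group Q R : (forall t, Q t \subset Wc t) ->
    (forall t, R t \subset Wc t) ->
  #|'Fix_(rcosets (prod_group R) W | 'Rs)(prod_group Q)| =
    (\prod_t #|'Fix_(rcosets (R t) (Wc t) | 'Rs)(Q t)|)%N.
Proof.
move=> sQ sR; apply/eqP; rewrite -(eqn_pmul2r (cardG_gt0 (prod_group R))).
rewrite -card_fix_rcosets ?prod_group_sub // card_prod_group // -big_split.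
rewrite -(eq_bigr _ (fun t _ => card_fix_rcosets (Q t) (sR t))) -card_proj.
  apply/eqP/eq_card => w; rewrite !inE; case: (boolP (w \in W)) => // Ww; rewrite !andTb.
  rewrite sub_prod_conj ?prod_group_sub //; apply: eq_forallb => t.
  by rewrite proj_prod_group // inE proj_mem.
by move=> t; apply/subsetP=> w; rewrite inE => /andP[].
Qed.

(** Whether H lies in a conjugate of a product subgroup depends only on its projections. This
    reduces all marks to those at product subgroups. *)
Lemma fix_proj (H : {group gT}) R : H \subset W ->
  #|'Fix_(rcosets (prod_group R) W | 'Rs)(H)| =
  #|'Fix_(rcosets (prod_group R) W | 'Rs)(prod_group (fun t => generated_group (p t @: H)))|.
Proof.
move=> sHW; apply/eqP; rewrite -(eqn_pmul2r (cardG_gt0 (prod_group R))).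
rewrite -!card_fix_rcosets ?prod_group_sub //.
apply/eqP/eq_card => w; rewrite !inE; case: (boolP (w \in W)) => // Ww; rewrite !andTb.
rewrite !sub_prod_conj ?prod_group_sub //; apply: eq_forallb => t.
rewrite proj_prod_group /= ?gen_subG //.
by apply/subsetP=> _ /imsetP[x Hx ->]; rewrite proj_mem // (subsetP sHW).
Qed.

Lemma gen_prod_group (J : {set gT}) : J \subset S ->
  <<J>>%G = prod_group (fun t => generated_group (J :&: Sc t)).
Proof.
move=> sJS; apply/val_inj/eqP; rewrite /= eqEsubset; apply/andP; split.
  rewrite (@gen_subG _ _ (prod_group _)); apply/subsetP=> s Js.
  have Ss := subsetP sJS _ Js; have [t st] := Sc_ex Ss.
  rewrite mem_prod_group (coxeter_mem WS) //; apply/forallP=> j.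
  have [e|nj] := eqVneq t j; last by rewrite (p_triv nj).
  by rewrite -e p_id // mem_gen // inE Js.
apply/subsetP=> w; rewrite inE => /andP[Ww /forallP Jw].
rewrite -(proj_prod Ww) group_prod // => t _.
by apply: subsetP (Jw t); rewrite genS ?subsetIl.
Qed.

Lemma replace_factor_prod_group t (H : {group gT}) : H \subset Wc t ->
  replace_factor Wc t H = prod_group (fun j => if j == t then H else Wc j).
Proof.
move=> sH; apply/val_inj/eqP; rewrite /replace_factor.
have E j : (if j == t then H else Wc j) \subset Wc j by case: eqP => [->|].
rewrite eqEsubset; apply/andP; split.
  elim/big_rec: _ => [|j G _ sG]; first by rewrite sub1G.
  rewrite /= join_subG sG andbT; apply/subsetP=> w jw.
  have wj := subsetP (E j) _ jw.
  rewrite mem_prod_group (subsetP (component_subW j)) //; apply/forallP=> i.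
  have [eij|nj] := eqVneq j i; last by rewrite (proj_triv nj).
  by rewrite -eij proj_id.
apply/subsetP=> w; rewrite inE => /andP[Ww /forallP Jw].
rewrite -(proj_prod Ww) group_prod // => j _; apply: subsetP (Jw j).
by rewrite (bigD1 j) //= joing_subl.
Qed.

End ProductSubgroups.

Local Open Scope ring_scope.

Lemma mark_prod_group (Q R : 'I_l -> {group gT}) : (forall t, Q t \subset Wc t) ->
    (forall t, R t \subset Wc t) ->
  mark (prod_group Q) (Gclass W (prod_group R)) =
    \prod_t mark (Q t) (Gclass (Wc t) (R t)).
Proof.
move=> sQ sR; rewrite mark_Gclass ?prod_group_sub // card_fix_prod_group //.
under [RHS]eq_bigr => t _ do rewrite mark_Gclass //.
by rewrite -natz natr_prod; apply: eq_bigr => t _; rewrite natz.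
Qed.

Lemma mark_parabolic (Q : 'I_l -> {group gT}) (J : {set gT}) :
    (forall t, Q t \subset Wc t) -> J \subset S ->
  mark (prod_group Q) (Gclass W <<J>>) =
    \prod_t mark (Q t) (Gclass (Wc t) (generated_group (J :&: Sc t))).
Proof.
move=> sQ sJS; rewrite gen_prod_group // mark_prod_group // => t.
by rewrite genS ?subsetIr.
Qed.

Lemma mark_component_embedding (Q : 'I_l -> {group gT}) t (x : burnside (Wc t)) :
    (forall t, Q t \subset Wc t) ->
  mark (prod_group Q) (component_embedding W Wc t x) = mark (Q t) x.
Proof.
move=> sQ; rewrite /component_embedding raddf_sum; apply: eq_bigr => C _.
have sC := subgroup_class_sub C.
rewrite raddfMz /= replace_factor_prod_group // mark_prod_group //; last first.
  by move=> j; case: eqP => [->|].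
rewrite (bigD1 t) //= eqxx big1 ?mulr1 => [|j /negPf->]; last by rewrite mark1.
by rewrite mark_Gclass // -mulrzr intz.
Qed.

Lemma mark_proj (x : burnside W) (H : {group gT}) : H \subset W ->
    partial_burnside (parabolics W S) x ->
  mark H x = mark (prod_group (fun t => generated_group (p t @: H))) x.
Proof.
move=> sHW; elim/partial_parabolics_ind => [y z e1 e2|y n e|J sJS].
- by rewrite !raddfD /= e1 e2.
- by rewrite !raddfMz /= e.
by rewrite gen_prod_group // !mark_Gclass ?prod_group_sub // fix_proj.
Qed.

Lemma component_embedding_partial t x :
  partial_burnside (parabolics (Wc t) (Sc t)) x ->
  partial_burnside (parabolics W S) (component_embedding W Wc t x).
Proof.
elim/partial_parabolics_ind => [y z e1 e2|y n e|J sJ].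
- by rewrite raddfD; apply: partial_burnsideD.
- by rewrite raddfMz; apply: partial_burnsideMz.
rewrite component_embedding_class ?genS //; first last.
- by move=> i nit; apply: components_cent; rewrite eq_sym.
- exact: component_subW.
rewrite replace_factor_prod_group ?genS //.
(* Putting <<J>> in place of W_t gives the standard parabolic generated by J and all the other
   components. *)
pose K := J :|: (S :\: Sc t).
have sKS : K \subset S by rewrite subUset (subset_trans sJ) // subsetDl.
suff -> : prod_group (fun j => if j == t then <<J>>%G else Wc j) = (<<K>> :^ 1)%G.
  by apply: partial_burnside_class; apply/imset2P; exists K 1%g; rewrite ?inE.
apply: val_inj; rewrite /= conjsg1 -[<<K>>]/(val <<K>>%G) (gen_prod_group sKS) /=.
apply/setP=> w; rewrite [LHS]inE [RHS]inE; congr (_ && _); apply: eq_forallb => j.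
have [->|njt] := eqVneq j t.
  congr (_ \in <<_>>)%g; rewrite setIUl (setIidPl sJ) setIDAC.
  by rewrite [X in _ :|: X](_ : _ = set0) ?setU0 // setDIl setDv setI0.
congr (_ \in <<_>>)%g; apply/esym/setIidPr; apply/subsetP=> s sj.
rewrite !inE (subsetP (Sc_sub j)) // andbT orbC.
by apply/orP; left; apply: contraNN njt => st; apply/eqP/(component_uniq Sc_inj Sc_components sj st).
Qed.

End Projections.

Local Open Scope ring_scope.

(** * Units *)

Definition update (I : eqType) (X : Type) (Q : I -> X) t x := fun i => if i == t then x else Q i.

Lemma updateC (I : eqType) (X : Type) (Q : I -> X) t j x y : t != j ->
  update (update Q t x) j y =1 update (update Q j y) t x.
Proof. by move=> /negPf ntj i; rewrite /update; case: eqP => // ->; rewrite eq_sym ntj. Qed.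

Lemma update_same (I : eqType) (X : Type) (Q : I -> X) t : update Q t (Q t) =1 Q.
Proof. by move=> i; rewrite /update; case: eqP => // ->. Qed.

Lemma update_update (I : eqType) (X : Type) (Q : I -> X) t x y :
  update (update Q t x) t y =1 update Q t y.
Proof. by move=> i; rewrite /update; case: eqP. Qed.

(** The sum of the four signs a, -b, -c, d is 4 minus twice the number of those equal to -1, so
    divisibility by 4 makes that number even. *)
Lemma alternating_sum_signs (a b c d k : int) :
  a * a = 1 -> b * b = 1 -> c * c = 1 -> d * d = 1 -> a - b - c + d = k *+ 4 ->
  a * b * c * d = 1.
Proof.
have sgn (x : int) : x * x = 1 -> x = 1 \/ x = -1.
  by rewrite -expr2 => /eqP; rewrite sqrf_eq1 => /orP[]/eqP; [left|right].
move=> /sgn[]-> /sgn[]-> /sgn[]-> /sgn[]->; lia.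
Qed.

(** * Sign functions on a grid *)

Section Grid.

Variables (I : finType) (X : Type) (ok : I -> pred X).
Implicit Types (Q : I -> X) (t j : I).

Definition valid Q := forall t, ok t (Q t).

Lemma valid_update Q t x : valid Q -> ok t x -> valid (update Q t x).
Proof. by move=> vQ okx i; rewrite /update; case: eqP => // ->. Qed.

Lemma update_invariant_const (R : Type) (Phi : (I -> X) -> R) Q0 Q :
    (forall Q Q', Q =1 Q' -> Phi Q = Phi Q') ->
    (forall Q j x, valid Q -> ok j x -> Phi (update Q j x) = Phi Q) ->
  valid Q0 -> valid Q -> Phi Q = Phi Q0.
Proof.
move=> ext inv vQ0 vQ.
(* Coordinates are replaced one at a time: those listed in r already come from Q. *)
have E (r : seq I) : Phi (fun i => if i \in r then Q i else Q0 i) = Phi Q0.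
  elim: r => [|j r IH]; first exact: ext.
  rewrite -IH -(inv (fun i => if i \in r then Q i else Q0 i) j (Q j)) //.
    by apply: ext => i; rewrite inE /update; case: eqP => [->|].
  by move=> i; case: ifP.
by rewrite -(E (enum I)); apply: ext => i; rewrite mem_enum.
Qed.

(** In the application the points are families of subgroups, o is trivial, s t is generated by a
    simple reflection of W_t, e t gives the marks of eps_t, and F the marks of a normalized unit at
    product subgroups. *)
Variables (o s : I -> X) (e : I -> X -> int) (F : (I -> X) -> int).
Hypotheses (ok_o : valid o) (ok_s : valid s).
Hypothesis F_ext : forall Q Q', Q =1 Q' -> F Q = F Q'.
Hypothesis F_line : forall Q t, valid Q -> exists c b : bool, forall x, ok t x ->
  F (update Q t x) = (-1) ^+ c * e t x ^+ b.
Hypothesis e_o : forall t, e t (o t) = 1.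
Hypothesis e_s : forall t, e t (s t) = -1.
Hypothesis e_sqr : forall t x, ok t x -> e t x * e t x = 1.
Hypothesis F_plane : forall Q t j, valid Q -> t != j ->
  F (update (update Q t (o t)) j (o j)) * F (update (update Q t (s t)) j (o j)) *
  F (update (update Q t (o t)) j (s j)) * F (update (update Q t (s t)) j (s j)) = 1.
Hypothesis F_base : F o = 1.
Hypothesis F_axis : forall t, F (update o t (s t)) = 1.

(** The slope of F along t: it equals (-1)^b for the exponent b of e_t on that line. *)
Let G t Q := F (update Q t (s t)) * F (update Q t (o t)).

Let G_ext t Q Q' : Q =1 Q' -> G t Q = G t Q'.
Proof.
by move=> eQ; congr (_ * _); apply: F_ext => i; rewrite /update eQ.
Qed.

(* The slope of F along t changes, under an update of another coordinate j, by
   the quotient of two functions of the form e_j ^+ b; the plane hypothesis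
   makes the two exponents equal. *)
Lemma grid_slope_update t Q j x : valid Q -> ok j x -> G t (update Q j x) = G t Q.
Proof.
move=> vQ okx; have [<-|njt] := eqVneq j t.
  by congr (_ * _); apply: F_ext; apply: update_update.
have const y : ok j y -> G t (update Q j y) = G t (update Q j (o j)).
  move=> oky; have [c [b L]] := F_line j (valid_update vQ (ok_s t)).
  have [c' [b' L']] := F_line j (valid_update vQ (ok_o t)).
  have GE z : ok j z -> G t (update Q j z) =
      ((-1) ^+ c * e j z ^+ b) * ((-1) ^+ c' * e j z ^+ b').
    move=> okz; rewrite -L // -L' //; congr (_ * _); apply: F_ext; apply: updateC => //.
  rewrite !GE //.
  have := F_plane vQ (t := t) (j := j); rewrite eq_sym => /(_ njt).
  rewrite !L ?L' // e_o e_s.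
  have := e_sqr oky; move: (e j y) => z z2 {L L' GE}.
  by case: c; case: c'; case: b; case: b'; rewrite ?expr1n ?expr0 ?expr1; nia.
rewrite const // -(const (Q j)) //; apply: G_ext; exact: update_same.
Qed.

(** The slopes do not depend on the line, so they equal their value 1 at the axes; every exponent b
    is then 0 and F is constant along each line. *)
Lemma grid_const Q : valid Q -> F Q = 1.
Proof.
have G1 t Q' : valid Q' -> G t Q' = 1.
  move=> vQ; rewrite (update_invariant_const (@G_ext t) (@grid_slope_update t) ok_o vQ).
  by rewrite /G F_axis mul1r -F_base; apply: F_ext; apply: update_same.
have F_o t Q' x : valid Q' -> ok t x -> F (update Q' t x) = F (update Q' t (o t)).
  move=> vQ okx; have [c [b L]] := F_line t vQ; have := G1 t _ vQ; rewrite /G !L //.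
  rewrite e_o e_s; case: b {L} => //.
  by rewrite expr1 expr1n mulr1 mulrN1 mulNr -expr2 sqrr_sign.
move=> vQ; rewrite -F_base; apply: update_invariant_const vQ => // Q' j x vQ' okx.
by rewrite F_o // -(F_o _ _ (Q' j)) //; apply: F_ext; apply: update_same.
Qed.

End Grid.

(** * Marks of units and parity at involutions *)

Section BurnsideMarks.

Variables (gT : finGroupType) (G : {group gT}).

Lemma markX (H : {group gT}) n (x : burnside G) : H \subset G ->
  mark H (x ^+ n) = mark H x ^+ n.
Proof.
move=> sHG; elim: n => [|n IH]; first by rewrite !expr0 [LHS]mark1.
by rewrite !exprS [LHS]markM // IH.
Qed.

Lemma markN1 (H : {group gT}) : H \subset G -> mark H (-1 : burnside G) = -1.
Proof. by move=> sHG; rewrite raddfN; congr (- _); apply: mark1. Qed.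

Lemma mark_prod (H : {group gT}) (I : finType) (A : {set I}) (x : I -> burnside G) :
  H \subset G -> mark H (\prod_(i in A) x i) = \prod_(i in A) mark H (x i).
Proof.
by move=> sHG; apply: (big_morph (mark H) (markM sHG)); rewrite [LHS]mark1.
Qed.

Lemma mark_unit_sqr (A : burnside G -> Prop) (H : {group gT}) x :
  units A x -> H \subset G -> mark H x * mark H x = 1.
Proof.
move=> [_ [y _ xy1]] sHG; have := congr1 (mark H) xy1.
rewrite [mark H (x * y)]markM // [mark H 1]mark1 // => e.
have := intUnitRing.unitzPl (etrans (mulrC _ _) e).
by rewrite qualifE /= => /orP[] /eqP->.
Qed.

Lemma units_sqr (A : burnside G -> Prop) x : A x ->
  (forall H : {group gT}, H \subset G -> mark H x * mark H x = 1) -> units A x.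
Proof.
move=> Ax x2; split=> //; exists x => //; apply: mark_inj => H sHG.
by rewrite [LHS]markM // x2 // [RHS]mark1.
Qed.

(** The points moved by an involution come in pairs. *)
Lemma mark_cycle_parity (K : {group gT}) (s : gT) : K \subset G -> s \in G ->
  #[s]%g = 2%N -> exists k : int, mark 1%G (Gclass G K) - mark <[s]>%G (Gclass G K) = k *+ 2.
Proof.
move=> sKG Gs s2; have sG : <[s]> \subset G by rewrite cycle_subG.
rewrite !mark_Gclass ?sub1G //.
have : #|'Fix_(rcosets K G | 'Rs)(1)| = #|rcosets K G| by rewrite afix1 setIT.
move=> /= ->.
have p2 : (2%N).-group <[s]> by rewrite /pgroup -orderE s2.
have := pgroup_fix_mod p2 (subset_trans sG (actsRs_rcosets K G)).
set a := #|rcosets K G|; set b := #|_| => /eqP e.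
have ba : (b <= a)%N by apply/subset_leq_card/subsetIl.
move: e; rewrite eqn_mod_dvd // => /dvdnP[k e]; exists k%:Z; lia.
Qed.

End BurnsideMarks.

(** * Units of a reducible Coxeter system *)

Section Units.

Variables (gT : finGroupType) (W : {group gT}) (S : {set gT}).
Variables (l : nat) (Sc : 'I_l -> {set gT}).
Hypothesis WS : coxeter_system W S.
Hypothesis Sc_inj : injective Sc.
Hypothesis Sc_components : [set Sc t | t : 'I_l] = coxeter_components S.

Let Wc t : {group gT} := <<Sc t>>%G.
Let eps t : burnside (Wc t) := sign_unit (Wc t) (Sc t).
Let Eps t : burnside W := component_embedding W Wc t (eps t).
Let Omega := partial_burnside (G := W) (parabolics W S).

Hypothesis card_units_Wt : forall t : 'I_l,
  has_card (units (partial_burnside (G := Wc t) (parabolics (Wc t) (Sc t)))) 4.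

Let cox t : coxeter_system (Wc t) (Sc t) := component_coxeter WS Sc_inj Sc_components t.

(** The elements 1, -1, eps_t, -eps_t are units, told apart by their marks at the trivial group and
    at a simple reflection; as there are only four units, these are all. *)
Lemma component_units t x : partial_burnside (parabolics (Wc t) (Sc t)) x ->
    (forall H : {group gT}, H \subset Wc t -> mark H x * mark H x = 1) ->
  exists c b : bool, x = (-1) ^+ c * eps t ^+ b.
Proof.
move=> Px x2; have ux := units_sqr Px x2.
have [ls [ls_uniq ls_size ls_mem]] := card_units_Wt t.
pose L := [seq (-1) ^+ cb.1 * eps t ^+ cb.2 | cb : bool * bool].
have [s st] := component_neq0 Sc_components t.
have sW : <[s]> \subset Wc t by rewrite cycle_subG mem_gen.
have m1 c b : mark 1%G ((-1) ^+ c * eps t ^+ b) = (-1) ^+ c.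
  rewrite [LHS]markM ?sub1G // !markX ?sub1G // markN1 ?sub1G //.
  by rewrite (mark1_sign_unit (cox t)) expr1n mulr1.
have ms c b : mark <[s]>%G ((-1) ^+ c * eps t ^+ b) = (-1) ^+ c * (-1) ^+ b.
  rewrite [LHS]markM // !markX // markN1 //.
  by rewrite (mark_cycle_sign_unit (cox t) st).
have sgn_inj (a b : bool) : (-1) ^+ a = (-1) ^+ b :> int -> a = b by case: a; case: b.
have L_uniq : uniq L.
  rewrite map_inj_uniq ?enum_uniq // => -[c b] [c' b'] /= E.
  have /sgn_inj ec : (-1) ^+ c = (-1) ^+ c' :> int by rewrite -(m1 c b) E m1.
  have := congr1 (mark <[s]>%G) E; rewrite !ms ec.
  by move/(mulrI (unitrX _ (unitrN1 _)))/sgn_inj => ->.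
have L_sub : {subset L <= ls}.
  move=> _ /mapP[[c b] _ ->] /=; apply/ls_mem/units_sqr.
    have collD := coxeter_collection (cox t).
    have P1 := partial_burnside1 collD.
    apply: partial_burnsideM => //; [case: c | case: b]; rewrite ?expr0 ?expr1 //.
      exact: partial_burnsideN.
    exact: sign_unit_partial.
  move=> H sH; pose y : burnside (Wc t) := (-1) ^+ c * eps t ^+ b.
  transitivity (mark H (y * y)); first by rewrite [RHS]markM.
  rewrite -expr2 /y exprMn sqrr_sign mul1r -exprM mulnC exprM expr2.
  by rewrite (sign_unit_sqr (cox t)) expr1n [LHS]mark1.
have [_ Leq] : (size L = size ls) * (L =i ls).
  by apply: uniq_min_size => //; rewrite ls_size size_map -cardE card_prod card_bool.
have : x \in L by rewrite Leq; apply/ls_mem.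
by case/mapP=> -[c b] _ ->; exists c, b.
Qed.

Variable p : 'I_l -> gT -> gT.
Hypothesis pM : forall t, {in W &, {morph p t : x y / (x * y)%g}}.
Hypothesis p_id : forall t, {in Sc t, p t =1 id}.
Hypothesis p_triv : forall t j, j != t -> {in Sc j, p t =1 fun=> 1%g}.

Let PG Q := prod_group pM Q.
Let okW t := [pred H : {group gT} | H \subset Wc t].

Lemma prod_group_ext Q Q' : Q =1 Q' -> PG Q = PG Q'.
Proof.
move=> eQ; apply/val_inj/setP=> w; rewrite /= !inE; congr (_ && _).
by apply: eq_forallb => t; rewrite eQ.
Qed.

Let markP Q (x : burnside W) := mark (PG Q) x.

Let markPD Q x y : markP Q (x + y) = markP Q x + markP Q y.
Proof. exact: raddfD. Qed.

Let markPMz Q x n : markP Q (x *~ n) = markP Q x * n.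
Proof. by rewrite /markP raddfMz /= mulrzz. Qed.

Let markP_parabolic Q (J : {set gT}) : valid okW Q -> J \subset S ->
  markP Q (Gclass W <<J>>) = \prod_t mark (Q t) (Gclass (Wc t) (generated_group (J :&: Sc t))).
Proof. by move=> vQ sJS; exact: (mark_parabolic WS Sc_inj Sc_components pM p_id p_triv vQ sJS). Qed.

(** On [W/<<J>>] the mark is a product over the components; the fixed factors become an integer
    coefficient of [W_t/<<J :&: S_t>>]. *)
Lemma mark_line (x : burnside W) Q t : valid okW Q -> Omega x ->
  exists2 y : burnside (Wc t), partial_burnside (parabolics (Wc t) (Sc t)) y &
    forall H : {group gT}, H \subset Wc t -> markP (update Q t H) x = mark H y.
Proof.
move=> vQ; elim/partial_parabolics_ind => [x1 x2 [y1 P1 E1] [y2 P2 E2]|x1 n [y P1 E]|J sJS].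
- exists (y1 + y2); first exact: partial_burnsideD.
  by move=> H sH; rewrite [RHS]raddfD /= -E1 // -E2.
- exists (y *~ n); first exact: partial_burnsideMz.
  by move=> H sH; rewrite [RHS]raddfMz /= -E // markPMz mulrzz.
exists (Gclass (Wc t) (generated_group (J :&: Sc t)) *~
  \prod_(j | j != t) mark (Q j) (Gclass (Wc j) (generated_group (J :&: Sc j)))).
  apply/partial_burnsideMz/partial_burnside_class/imset2P.
  exists (J :&: Sc t) 1%g; rewrite ?inE ?subsetIr //.
  by apply: val_inj; rewrite /= conjsg1.
move=> H sH; rewrite markP_parabolic //; last exact: valid_update.
rewrite raddfMz /= (bigD1 t) //= /update eqxx -mulrzr intz; congr (_ * _).
by apply: eq_bigr => j /negPf->.
Qed.

(** On [W/<<J>>] the alternating sum factors as a difference in direction t, a difference in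
    direction j and a remaining integer; both differences are even by [mark_cycle_parity]. *)
Lemma mark_plane (x : burnside W) Q t j (r s : gT) :
    valid okW Q -> t != j -> r \in Sc t -> s \in Sc j -> Omega x ->
  let m H K := markP (update (update Q t H) j K) x in
  exists k : int,
    m 1%G 1%G - m <[r]>%G 1%G - m 1%G <[s]>%G + m <[r]>%G <[s]>%G = k *+ 4.
Proof.
move=> vQ ntj rt sj; elim/partial_parabolics_ind => [x1 x2 [k1 /= E1] [k2 /= E2]|x1 n [k /= E]|J sJS] /=.
- exists (k1 + k2); rewrite !markPD mulrnDl -E1 -E2 !opprD.
  by rewrite (addrACA (markP _ x1)) (addrACA (_ - _)) (addrACA (_ - _ - _)).
- by exists (k * n); rewrite !markPMz -mulrnAl -E !mulrDl !mulNr.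
have okr : okW t <[r]>%G by rewrite /= cycle_subG mem_gen.
have oks : okW j <[s]>%G by rewrite /= cycle_subG mem_gen.
have ok1 i : okW i 1%G by rewrite /= sub1G.
pose g i := generated_group (J :&: Sc i).
have sg i : g i \subset Wc i by rewrite genS ?subsetIr.
have [k Ek] := mark_cycle_parity (sg t) (mem_gen rt) (coxeter_invol (cox t) rt).
have [k' Ek'] := mark_cycle_parity (sg j) (mem_gen sj) (coxeter_invol (cox j) sj).
pose R := \prod_(i | (i != t) && (i != j)) mark (Q i) (Gclass (Wc i) (g i)).
have E H K : okW t H -> okW j K -> markP (update (update Q t H) j K) (Gclass W <<J>>) =
    mark H (Gclass (Wc t) (g t)) * (mark K (Gclass (Wc j) (g j)) * R).
  move=> okH okK; rewrite markP_parabolic //; last by do 2 apply: valid_update => //.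
  rewrite (bigD1 t) //= (bigD1 j) 1?eq_sym //= /update (negPf ntj) !eqxx.
  congr (_ * (_ * _)); apply: eq_bigr => i /andP[/negPf-> /negPf->] //.
exists (k * k' * R); rewrite !E //.
have -> : mark 1%G (Gclass (Wc t) (g t)) = k *+ 2 + mark <[r]>%G (Gclass (Wc t) (g t)).
  by rewrite -Ek subrK.
have -> : mark 1%G (Gclass (Wc j) (g j)) = k' *+ 2 + mark <[s]>%G (Gclass (Wc j) (g j)).
  by rewrite -Ek' subrK.
ring.
Qed.

Lemma mark_eq1 (x : burnside W) : Omega x ->
  (forall Q, valid okW Q -> markP Q x = 1) -> x = 1.
Proof.
move=> Ox E; apply: mark_inj => H sHW; rewrite [RHS]mark1 //.
rewrite (mark_proj WS Sc_inj Sc_components pM p_id p_triv sHW Ox); apply: E => t /=.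
rewrite gen_subG; apply/subsetP=> _ /imsetP[w Hw ->].
exact: (proj_mem WS Sc_components pM p_id p_triv _ (subsetP sHW _ Hw)).
Qed.

Let markP_Eps Q t : valid okW Q -> markP Q (Eps t) = mark (Q t) (eps t).
Proof. by move=> vQ; exact: (mark_component_embedding WS Sc_inj Sc_components pM p_id p_triv _ vQ). Qed.

Let o (t : 'I_l) : {group gT} := 1%G.
Let ok_o : valid okW o. Proof. by move=> t; apply: sub1G. Qed.

Lemma unit_normalized_eq1 (x : burnside W) (s : 'I_l -> gT) :
    (forall t, s t \in Sc t) -> Omega x ->
    (forall H : {group gT}, H \subset W -> mark H x * mark H x = 1) ->
    markP o x = 1 -> (forall t, markP (update o t <[s t]>%G) x = 1) ->
  x = 1.
Proof.
move=> s_in Ox x2 xo xs; apply: mark_eq1 => // Q.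
have sP Q' : PG Q' \subset W by apply: prod_group_sub.
apply: (@grid_const _ _ okW o (fun t => <[s t]>%G) (fun t H => mark H (eps t)) (markP^~ x)) => //=.
- by move=> t; rewrite /= cycle_subG mem_gen.
- by move=> Q1 Q2 eQ; rewrite /markP (prod_group_ext eQ).
- move=> Q' t vQ; have [y Py Ey] := mark_line t vQ Ox.
  have [H sH|c [b yE]] := component_units Py; first by rewrite -!Ey ?x2.
  exists c, b => H sH; rewrite Ey // yE [LHS]markM // !markX // markN1 //.
- by move=> t; exact: (mark1_sign_unit (cox t)).
- by move=> t; exact: (mark_cycle_sign_unit (cox t) (s_in t)).
- by move=> t H sH; exact: (mark_sign_unit_sqr (cox t) sH).
move=> Q' t j vQ ntj; have [k Ek] := mark_plane vQ ntj (s_in t) (s_in j) Ox.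
by apply: (alternating_sum_signs _ _ _ _ Ek); apply: x2.
Qed.

Definition signed_product (cB : bool * {set 'I_l}) : burnside W :=
  (-1) ^+ cB.1 * \prod_(t in cB.2) Eps t.

Let collW : collection W (parabolics W S) := coxeter_collection WS.

Let Omega1 : Omega 1. Proof. exact: partial_burnside1 collW. Qed.

Let OmegaM x y : Omega x -> Omega y -> Omega (x * y).
Proof. by move=> Ox Oy; apply: (partial_burnsideM collW). Qed.

Let Eps_partial t : Omega (Eps t).
Proof.
apply: (component_embedding_partial WS Sc_inj Sc_components pM p_id p_triv).
exact: sign_unit_partial.
Qed.

Let Omega_sign (c : bool) : Omega ((-1) ^+ c).
Proof. by case: c => //; rewrite expr1; apply: partial_burnsideN. Qed.

Let Omega_prod (B : {set 'I_l}) : Omega (\prod_(t in B) Eps t).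
Proof.
by elim/big_rec: _ => // t x _ Ox; apply: OmegaM.
Qed.

Let Eps_sqr t : Eps t * Eps t = 1.
Proof.
apply: mark_eq1 => [|Q vQ]; first exact: OmegaM.
have E : mark (PG Q) (Eps t) = mark (Q t) (eps t) by apply: markP_Eps.
rewrite /markP [LHS]markM ?prod_group_sub // E.
exact: (mark_sign_unit_sqr (cox t) (vQ t)).
Qed.

Lemma signed_product_partial cB : Omega (signed_product cB).
Proof. exact: OmegaM. Qed.

Lemma signed_product_sqr cB : signed_product cB * signed_product cB = 1.
Proof.
rewrite /signed_product mulrACA -expr2 sqrr_sign mul1r -big_split /=.
by rewrite big1 // => t _; apply: Eps_sqr.
Qed.

Lemma signed_product_unit cB : units Omega (signed_product cB).
Proof.
split; first exact: signed_product_partial.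
by exists (signed_product cB); [apply: signed_product_partial | apply: signed_product_sqr].
Qed.

Let markP_signed_product Q cB : valid okW Q ->
  markP Q (signed_product cB) = (-1) ^+ cB.1 * \prod_(t in cB.2) mark (Q t) (eps t).
Proof.
move=> vQ; have sQ : PG Q \subset W by apply: prod_group_sub.
rewrite /markP [LHS]markM // markX // markN1 // mark_prod //; congr (_ * _).
by apply: eq_bigr => t _; apply: markP_Eps.
Qed.

Variable s : 'I_l -> gT.
Hypothesis s_in : forall t, s t \in Sc t.

Let axis t := update o t <[s t]>%G.

Let ok_axis t : valid okW (axis t).
Proof. by apply: valid_update => //; rewrite /= cycle_subG mem_gen. Qed.

Let markP_signed_product1 cB : markP o (signed_product cB) = (-1) ^+ cB.1.
Proof.
rewrite markP_signed_product // big1 ?mulr1 // => t _.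
exact: mark1_sign_unit (cox t).
Qed.

Let markP_signed_product_axis cB t :
  markP (axis t) (signed_product cB) = (-1) ^+ cB.1 * (-1) ^+ (t \in cB.2).
Proof.
rewrite markP_signed_product //; congr (_ * _).
have E j : mark (axis t j) (eps j) = if j == t then -1 else 1.
  rewrite /axis /update; case: eqP => [->|_]; last exact: mark1_sign_unit (cox j).
  exact: (mark_cycle_sign_unit (cox t) (s_in t)).
under eq_bigr => j _ do rewrite E.
rewrite -big_mkcondr /=; case: (boolP (t \in cB.2)) => tB.
  by rewrite (big_pred1 t) // => j /=; case: eqP => [->|]; rewrite ?tB ?andbF.
by rewrite big_pred0 // => j /=; case: eqP => [->|]; rewrite ?(negPf tB) ?andbF.
Qed.

Lemma signed_product_inj : injective signed_product.
Proof.
have sgn_inj (a b : bool) : (-1) ^+ a = (-1) ^+ b :> int -> a = b by case: a; case: b.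
move=> [c B] [c' B'] E.
have ec : c = c'.
  by apply: sgn_inj; rewrite -[LHS](markP_signed_product1 (c, B)) E markP_signed_product1.
congr (_, _) => //; apply/setP=> t.
have := markP_signed_product_axis (c, B) t.
by rewrite E markP_signed_product_axis /= ec => /(mulrI (unitrX _ (unitrN1 _)))/sgn_inj.
Qed.

Lemma unit_signed_product x : units Omega x -> exists cB, x = signed_product cB.
Proof.
move=> ux; have Ox : Omega x by case: ux.
have sgn (y : int) : y * y = 1 -> exists c : bool, y = (-1) ^+ c.
  by rewrite -expr2 => /eqP; rewrite sqrf_eq1 => /orP[]/eqP->; [exists false | exists true].
have sP Q : PG Q \subset W by apply: prod_group_sub.
have [c xo] := sgn _ (mark_unit_sqr ux (sP o)).
(* With B the set of axes on which the mark of x changes sign, x and the signed product for (c, B)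
   agree at the base point and on the axes, so their product is normalized. *)
pose B := [set t | markP (axis t) x != (-1) ^+ c].
exists (c, B); set w := signed_product (c, B).
have Ow : Omega w by apply: signed_product_partial.
suff xw1 : x * w = 1 by rewrite -[x]mulr1 -(signed_product_sqr (c, B)) mulrA xw1 mul1r.
apply: (unit_normalized_eq1 s_in) => [|H sH||t]; first exact: OmegaM.
- rewrite [mark H _]markM // mulrACA (mark_unit_sqr ux) // mul1r.
  exact: (mark_unit_sqr (signed_product_unit _) sH).
- rewrite /markP [LHS]markM // xo -/(markP o w) markP_signed_product1 /=.
  by rewrite -expr2 sqrr_sign.
rewrite /markP [LHS]markM // -/(markP (axis t) w) -/(markP (axis t) x).
rewrite markP_signed_product_axis /= inE.
have [c' xt] := sgn _ (mark_unit_sqr ux (sP (axis t))).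
by rewrite [markP (axis t) x]xt {xo w Ow B xt}; case: c; case: c'.
Qed.

Lemma component_units_product :
  has_card (units Omega) (2 ^ l.+1)%N /\
  (forall x : burnside W, units Omega x <->
     generated_units (fun u => u = -1 \/ exists t, u = Eps t) x).
Proof.
split.
  exists [seq signed_product cB | cB : bool * {set 'I_l}]; split.
  - by rewrite map_inj_uniq ?enum_uniq //; apply: signed_product_inj.
  - by rewrite size_map -cardE card_prod card_bool -cardsT -powersetT card_powerset cardsT card_ord expnS.
  move=> x; split=> [/mapP[cB _ ->]|/unit_signed_product[cB ->]].
    exact: signed_product_unit.
  by apply: map_f; rewrite mem_enum.
move=> x; split=> [/unit_signed_product[[c B] ->]|].
  apply: generated_unitsM.
    case: c; last exact: generated_units1.
    by apply: generated_units_mem; left.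
  elim/big_rec: _ => [|t y _ gy]; first exact: generated_units1.
  by apply: generated_unitsM => //; apply: generated_units_mem; right; exists t.
elim=> {x} [x [->|[t ->]]||x y _ [Ox [x' Ox' xx']] _ [Oy [y' Oy' yy']]|x y _ [Ox [x' Ox' xx']] xy].
- have ON1 : Omega (-1) by apply: (Omega_sign true).
  by split=> //; exists (-1) => //; rewrite mulrNN mulr1.
- by split=> //; exists (Eps t).
- by split=> //; exists 1; rewrite ?mulr1.
- split; first exact: OmegaM.
  by exists (x' * y'); [apply: OmegaM | rewrite mulrACA xx' yy' mulr1].
have yx' : y = x' by rewrite -[y]mul1r -xx' mulrAC xy mul1r.
by split; [rewrite yx' | exists x => //; rewrite mulrC].
Qed.

End Units.

Theorem corollary4p7 (gT : finGroupType) (W : {group gT}) (S : {set gT})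
    (l : nat) (Sc : 'I_l -> {set gT})
    (WS_coxeter : coxeter_system W S)
    (Sc_inj : injective Sc)
    (Sc_components : [set Sc t | t : 'I_l] = coxeter_components S)
    (W_reducible : (1 < l)%N)
    (card_units_Wt : forall t : 'I_l,
       has_card
         (units (partial_burnside (G := <<Sc t>>) (parabolics <<Sc t>> (Sc t))))
         4) :
  has_card (units (partial_burnside (G := W) (parabolics W S))) (2 ^ l.+1)%N /\
  (forall x : burnside W,
     units (partial_burnside (parabolics W S)) x <->
     generated_units
       (fun u : burnside W => u = -1 \/
          exists t : 'I_l,
            u = component_embedding W (fun i => <<Sc i>>%G) t
                  (sign_unit <<Sc t>> (Sc t)))
       x).
Proof.
have [p pP] := component_projections WS_coxeter Sc_inj Sc_components.
have [s s_in] := fin_all_exists (component_neq0 Sc_components).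
have pM t : {in W &, {morph p t : x y / (x * y)%g}} by case: (pP t).
have p_id t : {in Sc t, p t =1 id} by case: (pP t).
have p_triv t j : j != t -> {in Sc j, p t =1 fun=> 1%g}.
  by case: (pP t) => _ _; apply.
exact: (component_units_product WS_coxeter Sc_inj Sc_components card_units_Wt pM p_id p_triv s_in).
Qed.
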